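(* Assume that $G:\mathbb{R}\times X\times X\to X$ is continuous, that $p:\mathbb{R}\times X\to X$ satisfies $\|p(t,u)-p(s,v)\|\le L_p(|s-t|+\|u-v\|)$ for some $L_p\ge0$ and $\|p(s,u)\|\le C_1\|u\|+C_2$ for some $C_1,C_2\ge0$ and all $(t,u),(s,v)\in\mathbb{R}\times X$, and that (A1), (A2), (A3) hold. Then for every $\varphi\in C$ the initial value problem $\frac{du(t)}{dt}+Au(t)=B(t,u_t)$, $t\ge a$, $u_a=\varphi$, possesses a mild solution (on $[a-r,T]$ for some $T>a$).
   Context: Let $X$ be a Banach space with norm $\|\cdot\|$, $r>0$, $a\in\mathbb{R}$, and $C=C([-r,0];X)$ with the supremum norm $\|\cdot\|_C$. For a continuous $u:[a-r,b]\to X$ and $t\in[a,b]$, $u_t\in C$ denotes $u_t(\theta)=u(t+\theta)$, $\theta\in[-r,0]$. Let $A$ be the infinitesimal generator of a compact $C_0$-semigroup $\{e^{-At}\}_{t\ge0}$ on $X$ with $\|e^{-At}\|\le e^{\omega t}$ for all $t\ge0$, for a fixed $\omega\in\mathbb{R}$. The nonlinearity is $B(t,\psi)=G(t,\psi(0),F(t,\psi))$ with $F(t,\psi)=\int_{-r}^0 p(t,\psi(\theta))\,dg(\theta,t,\psi)$ (Stieltjes integral in $\theta$), where $g:[-r,0]\times\mathbb{R}\times C\to\mathbb{R}$. (A1): for every $(t,\varphi)$, $g(\cdot,t,\varphi)$ has bounded variation on $[-r,0]$ and $V_{-r}^0g(\cdot,t,\varphi)\le M_{Vg}$ for a constant $M_{Vg}>0$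 independent of $(t,\varphi)$. Write $g=g_d+g_c$, where $g_d(\cdot,t,\varphi)$ is the jump (step-function) part and $g_c=g_{ac}+g_s$ the continuous part (absolutely continuous plus singular continuous) of $g(\cdot,t,\varphi)$. (A2): for each $\theta\in[-r,0]$, $(t,\varphi)\mapsto g_c(\theta,t,\varphi)$ is continuous on $\mathbb{R}\times C$. (A3): the jump points of $g_d(\cdot,t,\varphi)$ are $\theta_k=-\eta_k(t,\varphi)$ with jumps $h_k(t,\varphi)=g_d(\theta_k+0,t,\varphi)-g_d(\theta_k-0,t,\varphi)$, where $\eta_k:\mathbb{R}\times C\to[0,r]$, $h_k:\mathbb{R}\times C\to\mathbb{R}$ are continuous, and $\sum_k h_k(t,\varphi)$ converges absolutely and uniformly on bounded subsets of $\mathbb{R}\times C$. A mild solution on $[a-r,T]$ is a function $u\in C([a-r,T];X)$ with $u_a=\varphi$ and $u(t)=e^{-A(t-a)}\varphi(0)+\int_a^t e^{-A(t-s)}B(s,u_s)\,ds$ for $t\in[a,T]$. *)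

(* Defs.v *)
From HB Require Import structures.
From mathcomp Require Import all_boot all_order all_algebra.
From mathcomp Require Import all_classical all_reals all_analysis.
Set Implicit Arguments. Unset Strict Implicit. Unset Printing Implicit Defensive.
Import Order.TTheory GRing.Theory Num.Theory.
Import numFieldNormedType.Exports.
Local Open Scope classical_set_scope.
Local Open Scope ring_scope.

Section Defs.
Context {R : realType}.

Section Integrals.
Context {X : normedModType R}.

Definition tagged_partition (a b : R) (n : nat) (x xi : nat -> R) :=
  [/\ x 0%N = a, x n = b & forall i, (i < n)%N -> x i <= xi i <= x i.+1].

Definition mesh_lt (n : nat) (x : nat -> R) (d : R) :=
  forall i, (i < n)%N -> x i.+1 - x i < d.

Definition RS_sum (f : R -> X) (g : R -> R) (n : nat) (x xi : nat -> R) : X :=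
  \sum_(i < n) (g (x i.+1) - g (x i)) *: f (xi i).

Definition is_RS_integral (f : R -> X) (g : R -> R) (a b : R) (I : X) :=
  forall e, 0 < e -> exists2 d, 0 < d &
    forall n x xi, tagged_partition a b n x xi -> mesh_lt n x d ->
      `|RS_sum f g n x xi - I| < e.

Definition is_R_integral (f : R -> X) (a b : R) (I : X) :=
  is_RS_integral f id a b I.

Definition RS_integral (f : R -> X) (g : R -> R) (a b : R) : X :=
  xget 0 [set I | is_RS_integral f g a b I].

End Integrals.

Section Phase.
Context {X : normedModType R}.

(* elements of C are represented by functions R -> X continuous on [-r,0] *)
Definition inC (r : R) (phi : R -> X) :=
  {within [set th | -r <= th <= 0], continuous phi}.

Definition ballC (r : R) (phi : R -> X) (d : R) (psi : R -> X) :=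
  forall th, -r <= th <= 0 -> `|psi th - phi th| < d.

Definition boundedC (r : R) (phi : R -> X) (K : R) :=
  forall th, -r <= th <= 0 -> `|phi th| <= K.

Definition continuous_RC {Y : normedModType R} (r : R)
    (F : R -> (R -> X) -> Y) :=
  forall t phi, inC r phi -> forall e, 0 < e -> exists2 d, 0 < d &
    forall s psi, inC r psi -> `|s - t| < d -> ballC r phi d psi ->
      `|F s psi - F t phi| < e.

Definition seg (u : R -> X) (t : R) : R -> X := fun th => u (t + th).

End Phase.

(* ---------- compact C0-semigroups {e^{-At}} with ||e^{-At}|| <= e^{wt} ---------- *)
Definition compact_C0_semigroup {X : normedModType R} (S : R -> X -> X) (w : R) :=
  [/\ (forall t, 0 <= t -> forall (c : R) (x y : X), S t (c *: x + y) = c *: S t x + S t y),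
      (forall x, S 0 x = x) /\
      (forall t s, 0 <= t -> 0 <= s -> forall x, S (t + s) x = S t (S s x)),
      (forall x, S t x @[t --> 0^'+] --> x),
      (forall t, 0 <= t -> forall x, `|S t x| <= expR (w * t) * `|x|) &
      (forall t, 0 < t -> compact (closure [set S t x | x in [set x | `|x| <= 1]]))].

(* normalized step: jump at theta_k, counted from the right of theta_k,
   except that a jump at the right end point 0 is counted at 0 *)
Definition jump_step (thk th : R) : R := if (thk < th) || (th == 0) then 1 else 0.

Definition jump_decomposition {X : normedModType R} (r : R)
    (g : R -> R -> (R -> X) -> R) (gc : R -> R -> (R -> X) -> R)
    (eta h : nat -> R -> (R -> X) -> R) :=
  [/\
      (forall t phi, inC r phi ->
         {within [set th | -r <= th <= 0], continuous (fun th => gc th t phi)}),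
      (forall th, -r <= th <= 0 -> continuous_RC r (gc th)),
      (forall k, continuous_RC r (eta k) /\ continuous_RC r (h k) /\
         forall t phi, inC r phi -> 0 <= eta k t phi <= r),
      (forall K e, 0 < e -> exists N : nat, forall (m n : nat) t phi, inC r phi ->
          (N <= m)%N -> `|t| <= K -> boundedC r phi K ->
          \sum_(m <= k < n) `|h k t phi| <= e) &
      (* g_d := g - g_c is the step function with jumps h_k at theta_k = -eta_k
         (off the interior jump points, whose values do not matter) *)
      (forall t phi th, inC r phi -> -r <= th <= 0 ->
         (th = -r \/ th = 0 \/ forall k, th != - eta k t phi) ->
         (fun n => \sum_(k < n) h k t phi * jump_step (- eta k t phi) th)
            @ \oo --> g th t phi - gc th t phi)].

Definition Fnl {X : normedModType R} (r : R) (p : R -> X -> X)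
    (g : R -> R -> (R -> X) -> R) (t : R) (psi : R -> X) : X :=
  RS_integral (fun th => p t (psi th)) (fun th => g th t psi) (-r) 0.

Definition Bnl {X : normedModType R} (r : R) (G : R -> X -> X -> X)
    (p : R -> X -> X) (g : R -> R -> (R -> X) -> R) (t : R) (psi : R -> X) : X :=
  G t (psi 0) (Fnl r p g t psi).

Definition mild_solution {X : normedModType R} (r a T : R) (S : R -> X -> X)
    (B : R -> (R -> X) -> X) (phi : R -> X) (u : R -> X) :=
  [/\ {within [set s | a - r <= s <= T], continuous u},
      (forall th, -r <= th <= 0 -> u (a + th) = phi th) &
      (forall t, a <= t <= T -> exists2 I : X,
          is_R_integral (fun s => S (t - s) (B s (seg u s))) a t I &
          u t = S (t - a) (phi 0) + I)].

End Defs.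

(* Main.v *)
Require Import Defs.
From HB Require Import structures.
From mathcomp Require Import all_boot all_order all_algebra.
From mathcomp Require Import all_classical all_reals all_analysis.
From mathcomp Require Import ring lra.
Import Order.TTheory GRing.Theory Num.Theory.
Import numFieldNormedType.Exports.
Local Open Scope classical_set_scope.
Local Open Scope ring_scope.
Set Implicit Arguments. Unset Strict Implicit.

(** The nonlinearity [B] is continuous on R x C: if (t_n, phi_n) -> (t, phi), then
    g(th, t_n, phi_n) -> g(th, t, phi) at the end points and at every th off the
    countably many jump points involved, and Helly's theorem passes to the limit in the
    Stieltjes integral. For a continuous [B], the delayed equation
    u'(t) + A u(t) = B(t, u_(t - delta)) is solved explicitly, step by step, on an
    interval independent of delta. Compactness of the semigroup makes the Duhamel terms
    of these approximations equicontinuous and pointwise relatively compact, so that they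
    converge uniformly along an ultrafilter as delta -> 0, and the limit is a mild
    solution. *)

(** * Riemann-Stieltjes integrals *)

Section UniformContinuity.
Context {R : realType} {X : normedModType R}.

(** [B] is merely continuous on an infinite-dimensional space, so Picard iteration need not
    converge, and a bound on [B] is available only near (a, phi). A positive delay removes the fixed
    point problem: the right-hand side at time t then uses strictly earlier values only, and
    finitely many iterations solve the equation. The neighbourhood of (a, phi) on which [B] is
    bounded dictates the length of the interval.

    Two obstacles shape the rest. Jump points move with (t, phi), and over a whole neighbourhood
    they may fill an interval; along a sequence they stay countable, which is why continuity of the
    integral term is tested on sequences. Moreover [S 0] is the identity, which is not compact in
    infinite dimension, so the Duhamel integral cannot be treated in one piece: the last eps units
    of time are cut off, what remains factors through the compact [S eps], and the piece cut off is
    small uniformly in the approximations. The ultrafilter spares a diagonal choice of subsequences,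
    since it provides limits at all times simultaneously. *)

Definition unif_cont_on (a b : R) (f : R -> X) :=
  forall e, 0 < e -> exists2 d, 0 < d &
    forall s t, a <= s <= b -> a <= t <= b -> `|s - t| < d -> `|f s - f t| < e.

Lemma within_continuousP (a b : R) (f : R -> X) :
  {within [set x | a <= x <= b], continuous f} <->
  forall x, a <= x <= b -> forall e, 0 < e -> exists2 d, 0 < d &
    forall y, a <= y <= b -> `|x - y| < d -> `|f x - f y| < e.
Proof.
split.
- move=> /subspace_continuousP fc x abx e e0.
  have /cvgrPdist_lt/(_ e e0) := fc x abx.
  rewrite near_withinE => /nbhs_ballP[d /= d0 H].
  by exists d => // y aby xy; apply: H.
- move=> H; apply/subspace_continuousP => x abx.
  apply/cvgrPdist_lt => e e0; have [d d0 Hd] := H x abx e e0.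
  rewrite near_withinE; apply/nbhs_ballP; exists d => // y /= xy aby.
  exact: Hd.
Qed.

(** Finite subcovers in filter form: a bound that holds eventually around each point holds
    eventually on the whole segment. Heine-Cantor, boundedness and the uniform convergence along the
    ultrafilter are instances, with [F] equal to [0^'+], [+oo] and the ultrafilter. *)
Lemma segment_near_covering (I : Type) (F : set_system I) {FF : Filter F}
    (P : I -> R -> Prop) (a b : R) :
  (forall x, a <= x <= b -> exists2 d, 0 < d & \forall i \near F,
     forall y, a <= y <= b -> `|x - y| < d -> P i y) ->
  \forall i \near F, forall x, a <= x <= b -> P i x.
Proof.
move=> H; have := @segment_compact R a b.
move=> /compact_near_coveringP/near_covering_withinP/(_ I F P FF) cov.
have {}cov : \near F, [set` `[a, b]] `<=` P F.
  apply: cov => x /=; rewrite in_itv /= => abx; have [d d0 Hd] := H x abx.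
  exists (ball x d, fun i => forall y, a <= y <= b -> `|x - y| < d -> P i y).
    by split => //=; exact: nbhsx_ballx.
  by move=> [y i] /= [xy Hi]; rewrite in_itv /= => aby; exact: Hi.
apply: filterS cov => i Hi x abx.
by apply: Hi => /=; rewrite in_itv.
Qed.

Lemma Heine_Cantor (a b : R) (f : R -> X) :
  {within [set x | a <= x <= b], continuous f} -> unif_cont_on a b f.
Proof.
move=> /within_continuousP fc e e0.
have : \forall d \near 0^'+, forall s, a <= s <= b ->
    forall t, a <= t <= b -> `|s - t| < d -> `|f s - f t| < e.
  apply: segment_near_covering => x abx.
  have [d d0 Hd] := fc x abx (e / 2) ltac:(by rewrite divr_gt0).
  exists (d / 2); first by rewrite divr_gt0.
  near=> d' => y aby xy t abt yt.
  have d'd : d' < d / 2 by near: d'; apply: nbhs_right_lt; rewrite divr_gt0.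
  have h1 : `|f x - f y| < e / 2 by apply: Hd => //; lra.
  have h2 : `|f x - f t| < e / 2.
    by apply: Hd => //; have := ler_distD y x t; lra.
  have := ler_distD (f x) (f y) (f t); rewrite (distrC (f y) (f x)); lra.
move=> H; near (0:R)^'+ => d.
exists d; first by near: d; exact: nbhs_right_gt.
move=> s t abs abt; move: s abs t abt; near: d; exact: H.
Unshelve. all: by end_near. Qed.

Lemma within_continuous_bounded (a b : R) (f : R -> X) :
  {within [set x | a <= x <= b], continuous f} ->
  exists2 K, 0 <= K & forall x, a <= x <= b -> `|f x| <= K.
Proof.
move=> /within_continuousP fc.
have : \forall K \near +oo, forall x, a <= x <= b -> `|f x| <= K.
  apply: segment_near_covering => x abx.
  have [d d0 Hd] := fc x abx 1 ltr01; exists d => //; near=> K => y aby xy.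
  have := Hd y aby xy.
  have : `|f x| + 1 <= K by near: K; exact: nbhs_pinfty_ge.
  have := lerB_dist (f y) (f x); rewrite (distrC (f y)); lra.
move=> H; near (pinfty_nbhs R) => K; exists K.
  by near: K; exact: nbhs_pinfty_ge.
by near: K.
Unshelve. all: by end_near. Qed.

End UniformContinuity.

(** * Common refinements and estimates of Riemann-Stieltjes sums *)

Section RiemannStieltjes.
Context {R : realType} {X : normedModType R}.
Implicit Types (f : R -> X) (g v : R -> R).

(* [v] plays the role of the variation function of [g] *)
Definition dominated_on (a b : R) g v :=
  forall s t, a <= s -> s <= t -> t <= b -> `|g t - g s| <= v t - v s.

Lemma tagged_partition_bounds a b n (x xi : nat -> R) :
  tagged_partition a b n x xi -> forall i, (i <= n)%N -> a <= x i <= b.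
Proof.
move=> [x0 xn H].
have mono i j : (i <= j)%N -> (j <= n)%N -> x i <= x j.
  elim: j => [|j IH]; first by rewrite leqn0 => /eqP ->.
  rewrite leq_eqVlt => /predU1P[->//|ij] jn.
  have /andP[h1 h2] := H j jn.
  by apply: (le_trans (IH ij (ltnW jn))); exact: le_trans h1 h2.
by move=> i ilen; rewrite -x0 -xn !mono.
Qed.

Lemma tagged_partition_tag a b n (x xi : nat -> R) i :
  tagged_partition a b n x xi -> (i < n)%N -> a <= xi i <= b.
Proof.
move=> tp ilt; have [_ _ /(_ i ilt)/andP[h1 h2]] := tp.
have /andP[h3 _] := tagged_partition_bounds tp (ltnW ilt).
have /andP[_ h4] := tagged_partition_bounds tp ilt.
by rewrite (le_trans h3 h1) (le_trans h2 h4).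
Qed.

(* g-measure of the intersection of [x, x'] and [y, y'] *)
Definition cell g (x x' y y' : R) : R :=
  (g (Num.min x' y') - g (Num.min x' y)) - (g (Num.min x y') - g (Num.min x y)).

Lemma cell_sumr g x x' (m : nat) (y : nat -> R) :
  x <= x' -> y 0%N <= x -> x' <= y m ->
  \sum_(j < m) cell g x x' (y j) (y j.+1) = g x' - g x.
Proof.
move=> xx' y0 ym.
pose F j := g (Num.min x' (y j)) - g (Num.min x (y j)).
rewrite (eq_bigr (fun j : 'I_m => F j.+1 - F j)); last by move=> j _; rewrite /cell /F; lra.
rewrite -(big_mkord xpredT (fun j => F j.+1 - F j)) telescope_sumr // /F.
rewrite (min_l ym) (min_l (le_trans xx' ym)) (min_r y0) (min_r (le_trans y0 xx')).
by rewrite subrr subr0.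
Qed.

Lemma cellC g x x' y y' : cell g x x' y y' = cell g y y' x x'.
Proof.
rewrite /cell !(minC y') !(minC y); lra.
Qed.

(** Two intervals without overlap have a vanishing cell, for [g] and for [v] alike. If they overlap,
    the cell is the increment over the intersection, and the tags, each within [d] of a common
    point, are less than [d + d] apart. *)
Lemma norm_cell_le a b g v (f : R -> X) (K d x x' y y' s t : R) :
  dominated_on a b g v -> 0 <= K ->
  a <= x -> x <= x' -> x' <= b -> a <= y -> y <= y' -> y' <= b ->
  x <= s <= x' -> y <= t <= y' -> x' - x < d -> y' - y < d ->
  (forall s t, a <= s <= b -> a <= t <= b -> `|s - t| < d + d -> `|f s - f t| <= K) ->
  `|cell g x x' y y' *: (f s - f t)| <= K * cell v x x' y y'.
Proof.
move=> dom K0 ax xx' x'b ay yy' y'b /andP[xs sx'] /andP[yt ty'] xd yd H.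
have [x'y|yx'] := leP x' y.
  rewrite /cell (min_l x'y) (min_l (le_trans x'y yy')) (min_l (le_trans xx' x'y)).
  rewrite (min_l (le_trans xx' (le_trans x'y yy'))) !subrr scale0r normr0; lra.
have [y'x|xy'] := leP y' x.
  rewrite /cell (min_r y'x) (min_r (le_trans yy' y'x)).
  rewrite (min_r (le_trans y'x xx')) (min_r (le_trans yy' (le_trans y'x xx'))).
  rewrite !subrr scale0r normr0; lra.
have fst : `|f s - f t| <= K.
  by apply: H; [lra|lra|rewrite ltr_norml; lra].
have cellE h : cell h x x' y y' = h (Num.min x' y') - h (Num.max x y).
  rewrite /cell; have [|] := leP x y; have [|] := leP x' y';
    rewrite (min_r (ltW yx')) (min_l (ltW xy')); lra.
rewrite normrZ !cellE mulrC ler_pM //.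
apply: dom; rewrite ?ge_min ?le_max ?ax ?ay ?x'b ?y'b //.
by rewrite le_min !ge_max xx' (ltW yx') (ltW xy') yy'.
Qed.

(* Refining both partitions to their cells, the two sums differ only by the tags. *)
Lemma RS_sum_dist a b f g v (K d : R) n x xi m y zeta :
  dominated_on a b g v -> 0 <= K ->
  (forall s t, a <= s <= b -> a <= t <= b -> `|s - t| < d + d -> `|f s - f t| <= K) ->
  tagged_partition a b n x xi -> mesh_lt n x d ->
  tagged_partition a b m y zeta -> mesh_lt m y d ->
  `|RS_sum f g n x xi - RS_sum f g m y zeta| <= K * (v b - v a).
Proof.
move=> dom K0 H tx mx ty my.
have [x0 xn Hx] := tx; have [y0 ym Hy] := ty.
have bx i : (i <= n)%N -> a <= x i <= b := fun h => tagged_partition_bounds tx h.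
have by_ i : (i <= m)%N -> a <= y i <= b := fun h => tagged_partition_bounds ty h.
have xS i : (i < n)%N -> x i <= x i.+1 by move=> /Hx/andP[h1 h2]; exact: le_trans h2.
have yS i : (i < m)%N -> y i <= y i.+1 by move=> /Hy/andP[h1 h2]; exact: le_trans h2.
have row h (i : 'I_n) : \sum_(j < m) cell h (x i) (x i.+1) (y j) (y j.+1)
    = h (x i.+1) - h (x i).
  have /andP[h1 h2] := bx i (ltnW (ltn_ord i)); have /andP[h3 h4] := bx i.+1 (ltn_ord i).
  by rewrite cell_sumr // ?xS // ?y0 ?ym.
have col h (j : 'I_m) : \sum_(i < n) cell h (x i) (x i.+1) (y j) (y j.+1)
    = h (y j.+1) - h (y j).
  have /andP[h1 h2] := by_ j (ltnW (ltn_ord j)); have /andP[h3 h4] := by_ j.+1 (ltn_ord j).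
  under eq_bigr do rewrite cellC.
  by rewrite cell_sumr // ?yS // ?x0 ?xn.
have -> : RS_sum f g n x xi - RS_sum f g m y zeta =
    \sum_(i < n) \sum_(j < m) cell g (x i) (x i.+1) (y j) (y j.+1) *: (f (xi i) - f (zeta j)).
  rewrite /RS_sum.
  under eq_bigr do rewrite -row scaler_suml.
  under [X in _ - X]eq_bigr do rewrite -col scaler_suml.
  rewrite [X in _ - X]exchange_big /= -sumrB; apply: eq_bigr => i _.
  by rewrite -sumrB; apply: eq_bigr => j _; rewrite scalerBr.
apply: (@le_trans _ _ (\sum_(i < n) \sum_(j < m) K * cell v (x i) (x i.+1) (y j) (y j.+1))).
  apply: (le_trans (ler_norm_sum _ _ _)); apply: ler_sum => i _.
  apply: (le_trans (ler_norm_sum _ _ _)); apply: ler_sum => j _.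
  have /andP[h1 h2] := bx i (ltnW (ltn_ord i)); have /andP[h3 h4] := bx i.+1 (ltn_ord i).
  have /andP[h5 h6] := by_ j (ltnW (ltn_ord j)); have /andP[h7 h8] := by_ j.+1 (ltn_ord j).
  by apply: (norm_cell_le dom) => //; [exact: xS|exact: yS|exact: Hx|exact: Hy|exact: mx|exact: my|exact: H].
under eq_bigr do rewrite -mulr_sumr row.
rewrite -mulr_sumr -(big_mkord xpredT (fun i => v (x i.+1) - v (x i))) telescope_sumr //.
by rewrite x0 xn.
Qed.

(** The nodes are kept in a dense set [P] so that they can avoid the jump points of the
    integrators. *)
Lemma fine_partition (P : R -> Prop) (a b d : R) : a < b -> 0 < d -> P a -> P b ->
  (forall lo hi, a <= lo -> lo < hi -> hi <= b -> exists2 z, P z & lo < z < hi) ->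
  exists n x, [/\ tagged_partition a b n x x, mesh_lt n x d &
    forall i, (i <= n)%N -> P (x i)].
Proof.
move=> ab d0 Pa Pb dense.
(* The segment is cut into [m.+1] slots of length [h] with one node in each, the end slots taking
   [a] and [b]. Consecutive nodes are at most [h + h] apart, so [m] is chosen to make this less than
   [d]. *)
pose m := (Num.truncn (2 * (b - a) / d)).+1.
pose h := (b - a) / m.+1%:R.
have m0 : 0 < m.+1%:R :> R by rewrite ltr0n.
have h0 : 0 < h by rewrite divr_gt0 // subr_gt0.
have hm : h * m.+1%:R = b - a by rewrite /h divfK // gt_eqF.
have hd : h + h < d.
  have : 2 * (b - a) / d < m%:R by apply: truncnS_gt.
  rewrite ltr_pdivrMr // => H; have : m%:R < m.+1%:R :> R by rewrite ltr_nat.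
  move=> H'; rewrite -(ltr_pM2r m0) mulrDl hm.
  have : m%:R * d < d * m.+1%:R by rewrite mulrC ltr_pM2l.
  lra.
have /choice[z Hz] : forall i, exists z, (i <= m)%N ->
    P z /\ (a + h * i%:R < z < a + h * i.+1%:R).
  move=> i; have [im|im] := leqP i m; last by exists a.
  have [|||z Pz zi] := dense (a + h * i%:R) (a + h * i.+1%:R).
  - by rewrite lerDl mulr_ge0 // ltW.
  - by rewrite ltrD2l ltr_pM2l // ltr_nat.
  - have : h * i.+1%:R <= h * m.+1%:R by rewrite ler_pM2l // ler_nat.
    lra.
  by exists z.
pose x i := if i == 0%N then a else if i == m then b else z i.
have xP i : (i <= m)%N -> P (x i).
  by rewrite /x; case: eqP => // _; case: eqP => // _ /Hz[].
have xb i : (i <= m)%N -> a + h * i%:R <= x i <= a + h * i.+1%:R.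
  move=> im; rewrite /x; case: eqP => [->|_]; first by rewrite mulr0 mulr1; lra.
  case: eqP => [->|_]; last by have [_] := Hz i im; lra.
  have : h * m%:R <= h * m.+1%:R by rewrite ler_pM2l // ler_nat.
  lra.
exists m, x; split => //.
- split; [by []|by rewrite /x eqxx|].
  move=> i im; rewrite lexx /=.
  have := xb i (ltnW im); have := xb i.+1 im; lra.
- move=> i im; have := xb i (ltnW im); have := xb i.+1 im.
  rewrite -!natr1 !mulrDr !mulr1; lra.
Qed.

Lemma fine_partition_exists (a b d : R) : a <= b -> 0 < d ->
  exists n x, tagged_partition a b n x x /\ mesh_lt n x d.
Proof.
rewrite le_eqVlt => /predU1P[->|ab] d0.
  by exists 0%N, (fun=> b); split => //; split.
have [|n [x [tx mx _]]] := @fine_partition (fun=> True) a b d ab d0 I I.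
  by move=> lo hi _ lohi _; exists ((lo + hi) / 2) => //; lra.
by exists n, x.
Qed.

(** The hypothesis [a <= b] provides fine partitions; for [b < a] there is no tagged partition and
    every value is vacuously an integral. *)
Lemma is_RS_integral_unique a b f g I J : a <= b ->
  is_RS_integral f g a b I -> is_RS_integral f g a b J -> I = J.
Proof.
move=> ab HI HJ; apply/eqP; rewrite -subr_eq0 -normr_eq0 eq_le normr_ge0 andbT.
apply/ler_addgt0Pr => e e0; rewrite add0r.
have e20 : 0 < e / 2 by rewrite divr_gt0.
have [d1 d10 H1] := HI _ e20; have [d2 d20 H2] := HJ _ e20.
have [|n [x [tx mx]]] := @fine_partition_exists a b (Num.min d1 d2) ab.
  by rewrite lt_min d10.
have {}H1 : `|RS_sum f g n x x - I| < e / 2.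
  by apply: H1 => // i /mx; rewrite lt_min => /andP[].
have {}H2 : `|RS_sum f g n x x - J| < e / 2.
  by apply: H2 => // i /mx; rewrite lt_min => /andP[].
have := ler_distD (RS_sum f g n x x) I J; rewrite (distrC I (RS_sum _ _ _ _ _)); lra.
Qed.

Lemma RS_integralE a b f g I : a <= b ->
  is_RS_integral f g a b I -> RS_integral f g a b = I.
Proof.
move=> ab HI; rewrite /RS_integral; case: xgetP => [J _ HJ|/(_ I)//].
exact: is_RS_integral_unique HJ HI.
Qed.

(** The second partition in [RS_sum_dist] is refined to the limit. The error depends on [g] only
    through the total increment of [v], so a single partition serves a whole family of integrators
    of uniformly bounded variation. *)
Lemma RS_sum_approx a b f g v (K d : R) n x xi I : a <= b ->
  dominated_on a b g v -> 0 <= K -> 0 < d ->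
  (forall s t, a <= s <= b -> a <= t <= b -> `|s - t| < d + d -> `|f s - f t| <= K) ->
  tagged_partition a b n x xi -> mesh_lt n x d ->
  is_RS_integral f g a b I ->
  `|RS_sum f g n x xi - I| <= K * (v b - v a).
Proof.
move=> ab dom K0 d0 H tx mx HI.
apply/ler_addgt0Pr => e e0; have [d1 d10 H1] := HI _ e0.
have [|m [y [ty my]]] := @fine_partition_exists a b (Num.min d d1) ab.
  by rewrite lt_min d0.
have {}H1 : `|RS_sum f g m y y - I| < e.
  by apply: H1 => // i /my; rewrite lt_min => /andP[].
have H2 : `|RS_sum f g n x xi - RS_sum f g m y y| <= K * (v b - v a).
  by apply: (RS_sum_dist dom K0 H) => // i /my; rewrite lt_min => /andP[].
have := ler_distD (RS_sum f g m y y) (RS_sum f g n x xi) I; lra.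
Qed.

Lemma RS_sum_dist_integrand a b f1 f2 g v (K : R) n x xi :
  dominated_on a b g v -> 0 <= K ->
  (forall s, a <= s <= b -> `|f1 s - f2 s| <= K) ->
  tagged_partition a b n x xi ->
  `|RS_sum f1 g n x xi - RS_sum f2 g n x xi| <= K * (v b - v a).
Proof.
move=> dom K0 H tx; have [x0 xn Hx] := tx.
rewrite /RS_sum -sumrB; apply: (le_trans (ler_norm_sum _ _ _)).
rewrite -x0 -xn -(telescope_sumr (fun i => v (x i))) // big_mkord mulr_sumr.
apply: ler_sum => i _; rewrite -scalerBr normrZ mulrC ler_pM //.
  by apply: H; exact: tagged_partition_tag tx (ltn_ord i).
have /andP[h1 h2] := tagged_partition_bounds tx (ltnW (ltn_ord i)).
have /andP[h3 h4] := tagged_partition_bounds tx (ltn_ord i).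
apply: dom => //; have /andP[] := Hx i (ltn_ord i); exact: le_trans.
Qed.

Lemma RS_integral_dist a b f1 f2 g v (K : R) I1 I2 : a <= b ->
  dominated_on a b g v -> 0 <= K ->
  (forall s, a <= s <= b -> `|f1 s - f2 s| <= K) ->
  is_RS_integral f1 g a b I1 -> is_RS_integral f2 g a b I2 ->
  `|I1 - I2| <= K * (v b - v a).
Proof.
move=> ab dom K0 H HI HJ; apply/ler_addgt0Pr => e e0.
have e20 : 0 < e / 2 by rewrite divr_gt0.
have [d1 d10 H1] := HI _ e20; have [d2 d20 H2] := HJ _ e20.
have [|n [x [tx mx]]] := @fine_partition_exists a b (Num.min d1 d2) ab.
  by rewrite lt_min d10.
have {}H1 : `|RS_sum f1 g n x x - I1| < e / 2.
  by apply: H1 => // i /mx; rewrite lt_min => /andP[].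
have {}H2 : `|RS_sum f2 g n x x - I2| < e / 2.
  by apply: H2 => // i /mx; rewrite lt_min => /andP[].
have H3 := RS_sum_dist_integrand dom K0 H tx.
have := ler_distD (RS_sum f1 g n x x) I1 I2; rewrite (distrC I1 (RS_sum _ _ _ _ _)).
have := ler_distD (RS_sum f2 g n x x) (RS_sum f1 g n x x) I2; lra.
Qed.

Lemma eq_is_RS_integral a b f1 f2 g I :
  (forall s, a <= s <= b -> f1 s = f2 s) ->
  is_RS_integral f1 g a b I -> is_RS_integral f2 g a b I.
Proof.
move=> H HI e e0; have [d d0 Hd] := HI e e0; exists d => // n x xi tx mx.
suff -> : RS_sum f2 g n x xi = RS_sum f1 g n x xi by exact: Hd.
apply: eq_bigr => i _; rewrite H //; exact: tagged_partition_tag tx (ltn_ord i).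
Qed.

Lemma is_RS_integral0 a b g : is_RS_integral (fun=> 0 : X) g a b 0.
Proof.
move=> e e0; exists 1 => // n x xi _ _.
by rewrite /RS_sum big1 ?subr0 ?normr0 // => i _; rewrite scaler0.
Qed.

Lemma is_RS_integral_comp a b f g I (L : X -> X) (K : R) : 0 <= K ->
  (forall (c : R) x y, L (c *: x + y) = c *: L x + L y) ->
  (forall x, `|L x| <= K * `|x|) ->
  is_RS_integral f g a b I -> is_RS_integral (fun s => L (f s)) g a b (L I).
Proof.
move=> K0 Llin LK HI e e0.
have K1 : 0 < K + 1 by lra.
have [d d0 Hd] := HI (e / (K + 1)) ltac:(by rewrite divr_gt0).
exists d => // n x xi tx mx.
have L0 : L 0 = 0.
  by apply/eqP; rewrite -normr_le0; have := LK 0; rewrite normr0 mulr0.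
have LD u z : L (u + z) = L u + L z by rewrite -[u]scale1r Llin !scale1r.
have LZ c u : L (c *: u) = c *: L u by rewrite -[c *: u]addr0 Llin L0 addr0.
have LB u z : L (u - z) = L u - L z by rewrite -scaleN1r LD LZ scaleN1r.
have -> : RS_sum (fun s => L (f s)) g n x xi = L (RS_sum f g n x xi).
  rewrite /RS_sum (big_morph L LD L0); apply: eq_bigr => i _; exact/esym/LZ.
rewrite -LB; apply: (le_lt_trans (LK _)).
have := Hd n x xi tx mx; rewrite ltr_pdivlMr // => h.
apply: le_lt_trans h; rewrite mulrC ler_wpM2l //; lra.
Qed.

(** Integrability on the union is assumed: concatenated partitions all have [b] as a node, and so
    test only part of the partitions of [a, c]. *)
Lemma RS_integral_cat a b c f g I1 I2 I : a <= b -> b <= c ->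
  is_RS_integral f g a b I1 -> is_RS_integral f g b c I2 ->
  is_RS_integral f g a c I -> I = I1 + I2.
Proof.
move=> ab bc H1 H2 H3; apply/eqP; rewrite -subr_eq0 -normr_eq0 eq_le normr_ge0 andbT.
apply/ler_addgt0Pr => e e0; rewrite add0r.
have e30 : 0 < e / 3 by rewrite divr_gt0.
have [d1 d10 {}H1] := H1 _ e30; have [d2 d20 {}H2] := H2 _ e30.
have [d3 d30 {}H3] := H3 _ e30.
pose d := Num.min d1 (Num.min d2 d3).
have d0 : 0 < d by rewrite !lt_min d10 d20.
have [n [x [tx mx]]] := fine_partition_exists ab d0.
have [m [y [ty my]]] := fine_partition_exists bc d0.
have [x0 xn Hx] := tx; have [y0 ym Hy] := ty.
pose z i := if (i <= n)%N then x i else y (i - n)%N.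
have zl i : (i <= n)%N -> z i = x i by rewrite /z => ->.
have zr i : z (n + i)%N = y i.
  rewrite /z; have [|_] := leqP; last by rewrite addKn.
  rewrite -{2}[n]addn0 leq_add2l leqn0 => /eqP ->; by rewrite addn0 xn y0.
have tz : tagged_partition a c (n + m) z z.
  split; [by rewrite zl|by rewrite zr|move=> i inm; rewrite lexx /=].
  have [ni|ni] := leqP n i; last by rewrite !zl // ?(ltnW ni) //; have /andP[] := Hx i ni.
  rewrite -(subnKC ni) -addnS !zr.
  by have /andP[] := Hy (i - n)%N ltac:(by rewrite ltn_subLR).
have mz : mesh_lt (n + m) z d.
  move=> i inm; have [ni|ni] := leqP n i; last by rewrite !zl // ?(ltnW ni) //; exact: mx.
  rewrite -(subnKC ni) -addnS !zr; apply: my; by rewrite ltn_subLR.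
have md k w : mesh_lt k w d -> [/\ mesh_lt k w d1, mesh_lt k w d2 & mesh_lt k w d3].
  by move=> H; split=> i /H; rewrite !lt_min => /and3P[].
have {}H1 := H1 _ _ _ tx (ltac:(by have [] := md _ _ mx)).
have {}H2 := H2 _ _ _ ty (ltac:(by have [] := md _ _ my)).
have {}H3 := H3 _ _ _ tz (ltac:(by have [] := md _ _ mz)).
have E : RS_sum f g (n + m) z z = RS_sum f g n x x + RS_sum f g m y y.
  rewrite /RS_sum big_split_ord /=; congr (_ + _); apply: eq_bigr => i _.
    by rewrite !zl // ltnW.
  by rewrite -addnS !zr.
rewrite E in H3.
have := ler_distD (RS_sum f g n x x + RS_sum f g m y y) I (I1 + I2).
rewrite (distrC I (RS_sum f g n x x + _)).
have := ler_normD (RS_sum f g n x x - I1) (RS_sum f g m y y - I2).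
rewrite addrACA -opprD; lra.
Qed.

End RiemannStieltjes.

(** Cauchy criterion in which the approximating point may change with [e] and need not be a value of
    [u]; for the convolutions it is a limit of truncated terms. *)
Lemma cvg_of_near_approx {R : realType} {X : completeNormedModType R} (I : Type)
    (F : set_system I) {PF : ProperFilter F} (u : I -> X) :
  (forall e, 0 < e -> exists x, \forall i \near F, `|x - u i| < e) -> cvg (u @ F).
Proof.
move=> H; apply/cauchy_cvgP/cauchy_exP => e e0; have [x Hx] := H e e0.
by exists x; rewrite -ball_normE.
Qed.

Lemma RS_integrable {R : realType} {X : completeNormedModType R} (a b : R)
    (f : R -> X) (g v : R -> R) : a <= b ->
  dominated_on a b g v -> unif_cont_on a b f ->
  is_RS_integral f g a b (RS_integral f g a b).
Proof.
move=> ab dom uc.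
suff [I HI] : exists I, is_RS_integral f g a b I by rewrite (RS_integralE ab HI).
have V0 : 0 <= v b - v a.
  by apply: le_trans (dom a b _ _ _) => //.
(* Adding 1 allows the division when [v] has no increment. *)
have V1 : 0 < v b - v a + 1 by lra.
have key e : 0 < e -> exists2 d, 0 < d & forall n x xi m y zeta,
  tagged_partition a b n x xi -> mesh_lt n x d ->
  tagged_partition a b m y zeta -> mesh_lt m y d ->
  `|RS_sum f g n x xi - RS_sum f g m y zeta| < e.
  move=> e0; have K0 : 0 < e / (v b - v a + 1) by rewrite divr_gt0.
  have [d d0 Hd] := uc _ K0.
  exists (d / 2); first by rewrite divr_gt0.
  move=> n x xi m y zeta tx mx ty my.
  apply: (@le_lt_trans _ _ (e / (v b - v a + 1) * (v b - v a))).
    apply: (RS_sum_dist dom (ltW K0) _ tx mx ty my) => s t abs abt st.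
    by apply/ltW/Hd => //; lra.
  by rewrite -mulrA gtr_pMr // mulrC ltr_pdivrMr // mul1r; lra.
have /choice[N /choice[Y HY]] : forall k : nat, exists n, exists x,
    tagged_partition a b n x x /\ mesh_lt n x k.+1%:R^-1.
  by move=> k; apply: fine_partition_exists; rewrite ?invr_gt0.
pose u k := RS_sum f g (N k) (Y k) (Y k).
have meshY d : 0 < d -> \forall k \near \oo, mesh_lt (N k) (Y k) d.
  move=> d0; near=> k => i ik; have [_ /(_ i ik)] := HY k.
  move=> /lt_trans; apply; near: k; exact: near_infty_natSinv_lt (PosNum d0).
have /cvg_ex[I uI] : cvg (u @ \oo).
  apply: cvg_of_near_approx => e e0; have [d d0 Hd] := key e e0.
  have [q _ Hq] := meshY d d0; exists (u q); near=> p.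
  have [tp _] := HY p; have [tq _] := HY q.
  apply: Hd => //; first exact: Hq q (leqnn q).
  by near: p; exists q.
exists I => e e0.
have e20 : 0 < e / 2 by rewrite divr_gt0.
have [d d0 Hd] := key _ e20; exists d => // n x xi tx mx.
near \oo => q; have [tq _] := HY q.
have h1 : `|I - u q| < e / 2 by near: q; move/cvgrPdist_lt : uI; exact.
have h2 : `|RS_sum f g n x xi - u q| < e / 2.
  by apply: Hd => //; near: q; exact: meshY.
have := ler_distD (u q) (RS_sum f g n x xi) I; rewrite (distrC (u q) I); lra.
Unshelve. all: by end_near. Qed.

(** * Continuity of the nonlinearity *)

Lemma cvg_sum_ord {R : realType} {X : normedModType R} (I : Type)
    (F : set_system I) {FF : Filter F} (n : nat) (f : nat -> I -> X) (l : nat -> X) :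
  (forall k, (k < n)%N -> f k @ F --> l k) ->
  (fun i => \sum_(k < n) f k i) @ F --> \sum_(k < n) l k.
Proof.
elim: n => [|n IH] H.
  rewrite big_ord0 (_ : (fun _ => _) = fun=> 0); first exact: cvg_cst.
  by apply/funext => i; rewrite big_ord0.
rewrite big_ord_recr /= (_ : (fun _ => _) = (fun i => \sum_(k < n) f k i) \+ f n).
  by apply: cvgD; [apply: IH => k kn; apply: H; exact: ltnW|exact: H].
by apply/funext => i; rewrite big_ord_recr.
Qed.

(** A countable set is Lebesgue null, whereas the interval has positive length. *)
Lemma countable_avoid {R : realType} (E : set R) (lo hi : R) :
  countable E -> lo < hi -> exists2 z, ~ E z & lo < z < hi.
Proof.
move=> cE lohi; apply: contrapT => H.
have sub : [set` `]lo, hi[] `<=` E.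
  move=> z /=; rewrite in_itv /= => zlh; apply: contrapT => nEz.
  by apply: H; exists z.
have := lebesgue_measure_itv `]lo, hi[.
rewrite countable_lebesgue_measure0; last first.
  by apply: sub_countable cE; exact: subset_card_le.
rewrite /= lte_fin lohi -EFinD => -[] /eqP; rewrite eq_sym subr_eq0 => /eqP.
by move=> E'; rewrite E' ltxx in lohi.
Qed.

(** The witness is the variation function from [a]: by additivity its increments are the variations
    over subintervals, which bound the increments of [g]. *)
Lemma total_variation_dominated {R : realType} (a b : R) (g : R -> R) (V : R) :
  a <= b -> bounded_variation a b g -> (total_variation a b g <= V%:E)%E ->
  exists2 v, dominated_on a b g v & v b - v a <= V.
Proof.
move=> ab bv tvV; exists (fun t => fine (total_variation a t g)).
  move=> s t as_ st tb.
  have bvt : bounded_variation a t g := bounded_variationl (le_trans as_ st) tb bv.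
  have bvs : bounded_variation a s g := bounded_variationl as_ st bvt.
  have fs : total_variation a s g \is a fin_num by exact/bounded_variationP.
  have ft : total_variation a t g \is a fin_num.
    by apply/bounded_variationP => //; exact: le_trans st.
  have E := total_variationD g as_ st.
  have G := total_variation_ge g st.
  have fst : total_variation s t g \is a fin_num.
    by move: ft; rewrite E fin_numD => /andP[].
  move: G; rewrite -[total_variation s t g]fineK // lee_fin E fineD //; lra.
rewrite total_variationxx /= subr0 -lee_fin fineK //; exact/bounded_variationP.
Qed.

(* Helly's second theorem *)
Lemma RS_integral_cvg {R : realType} {X : completeNormedModType R} (a b V : R)
    (q : R -> X) (gn vn : nat -> R -> R) (g v : R -> R) (P : R -> Prop) :
  a < b -> unif_cont_on a b q ->
  (forall n, dominated_on a b (gn n) (vn n)) -> (forall n, vn n b - vn n a <= V) ->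
  dominated_on a b g v -> v b - v a <= V ->
  P a -> P b ->
  (forall lo hi, a <= lo -> lo < hi -> hi <= b -> exists2 z, P z & lo < z < hi) ->
  (forall z, P z -> (fun n => gn n z) @ \oo --> g z) ->
  (fun n => RS_integral q (gn n) a b) @ \oo --> RS_integral q g a b.
Proof.
move=> ab uc domn Vn dom vV Pa Pb dense gcvg; apply/cvgrPdist_lt => e e0.
have V0 : 0 <= V by apply: le_trans vV; exact: le_trans (dom a b _ (ltW ab) _).
(* Replacing each of the two integrals by its sum costs at most [K * V < e / 4], which leaves
   [e / 2] for the difference of the sums. *)
have K0 : 0 < e / (4 * (V + 1)) by rewrite divr_gt0 // mulr_gt0 //; lra.
set K := e / _ in K0.
have KV : K * V < e / 4.
  have -> : e / 4 = K * (V + 1) by rewrite /K; field; lra.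
  by rewrite ltr_pM2l //; lra.
have [d d0 Hd] := uc _ K0.
have d20 : 0 < d / 2 by rewrite divr_gt0.
have [n [x [tx mx Px]]] := fine_partition ab d20 Pa Pb dense.
have osc s t : a <= s <= b -> a <= t <= b -> `|s - t| < d / 2 + d / 2 -> `|q s - q t| <= K.
  by move=> abs abt st; apply/ltW/Hd => //; lra.
have h1 := RS_sum_approx (ltW ab) dom (ltW K0) d20 osc tx mx (RS_integrable (ltW ab) dom uc).
have h1V : K * (v b - v a) <= K * V by rewrite ler_pM2l.
(* The partition is fixed, so convergence at its finitely many nodes is enough; nothing uniform in
   the node is required. *)
have : (fun k => RS_sum q (gn k) n x x) @ \oo --> RS_sum q g n x x.
  apply: (@cvg_sum_ord _ _ _ _ _ n (fun i k => (gn k (x i.+1) - gn k (x i)) *: q (x i))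
    (fun i => (g (x i.+1) - g (x i)) *: q (x i))) => i ilt.
  apply: cvgZr_tmp; apply: cvgB; apply: gcvg; apply: Px => //; exact: ltnW.
move=> /cvgrPdist_lt/(_ (e / 2) ltac:(by rewrite divr_gt0)) H.
near=> k.
have h2 := RS_sum_approx (ltW ab) (domn k) (ltW K0) d20 osc tx mx
   (RS_integrable (ltW ab) (domn k) uc).
have h2V : K * (vn k b - vn k a) <= K * V by rewrite ler_pM2l.
have h3 : `|RS_sum q g n x x - RS_sum q (gn k) n x x| < e / 2 by near: k.
have := ler_distD (RS_sum q g n x x) (RS_integral q g a b) (RS_integral q (gn k) a b).
have := ler_distD (RS_sum q (gn k) n x x) (RS_sum q g n x x) (RS_integral q (gn k) a b).
rewrite (distrC (RS_integral q g a b) (RS_sum q g n x x)); lra.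
Unshelve. all: by end_near. Qed.

Section Nonlinearity.
Context {R : realType}.

Lemma continuous_RC_cvg {X Y : normedModType R} (r : R) (F : R -> (R -> X) -> Y)
    (t : R) (phi : R -> X) (s : nat -> R) (psi : nat -> R -> X) :
  continuous_RC r F -> inC r phi -> (forall n, inC r (psi n)) ->
  (forall n, `|s n - t| < n.+1%:R^-1) -> (forall n, ballC r phi n.+1%:R^-1 (psi n)) ->
  (fun n => F (s n) (psi n)) @ \oo --> F t phi.
Proof.
move=> Fc iphi ipsi st ball; apply/cvgrPdist_lt => e e0.
have [d d0 Hd] := Fc t phi iphi e e0; near=> n.
have nd : n.+1%:R^-1 < d by near: n; exact: near_infty_natSinv_lt (PosNum d0).
rewrite distrC; apply: Hd => //; first exact: lt_trans nd.
by move=> th thr; apply: lt_trans nd; exact: ball.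
Unshelve. all: by end_near. Qed.

(** * Convergence of the integrators away from the jump points *)

Section Jumps.
Context {X : normedModType R} (r : R) (g gc : R -> R -> (R -> X) -> R)
  (eta h : nat -> R -> (R -> X) -> R).
Hypothesis dec : jump_decomposition r g gc eta h.

Definition off_jumps (t : R) (phi : R -> X) (z : R) :=
  z = - r \/ z = 0 \/ forall k, z != - eta k t phi.

(** Each term of the jump series converges, because off the jump points its step is eventually
    constant along the sequence. The uniform tail of the jumps on bounded sets then exchanges the
    limit with the sum. *)
Lemma jump_cvg (t : R) (phi : R -> X) (s : nat -> R) (psi : nat -> R -> X) (z : R) :
  inC r phi -> (forall n, inC r (psi n)) ->
  (forall n, `|s n - t| < n.+1%:R^-1) -> (forall n, ballC r phi n.+1%:R^-1 (psi n)) ->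
  - r <= z <= 0 -> off_jumps t phi z -> (forall n, off_jumps (s n) (psi n) z) ->
  (fun n => g z (s n) (psi n)) @ \oo --> g z t phi.
Proof.
move=> iphi ipsi st ball zr ot on.
have [_ gcc ehc tail gd] := dec.
have gdt := gd t phi z iphi zr ot.
have gdn n := gd (s n) (psi n) z (ipsi n) zr (on n).
suff : (fun n => g z (s n) (psi n) - gc z (s n) (psi n)) @ \oo --> g z t phi - gc z t phi.
  have c := continuous_RC_cvg (gcc z zr) iphi ipsi st ball.
  move=> c'; rewrite -[g z t phi](subrK (gc z t phi)).
  rewrite (_ : (fun n => g z (s n) (psi n)) = (fun n => g z (s n) (psi n) -
    gc z (s n) (psi n)) \+ (fun n => gc z (s n) (psi n))); first exact: cvgD.
  by apply/funext => n /=; rewrite subrK.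
have jc k : (fun n => h k (s n) (psi n) * jump_step (- eta k (s n) (psi n)) z) @ \oo
    --> h k t phi * jump_step (- eta k t phi) z.
  have [ec [hc eb]] := ehc k.
  apply: cvgM; first exact: (continuous_RC_cvg hc iphi ipsi st ball).
  have ecv := continuous_RC_cvg ec iphi ipsi st ball.
  suff : \forall n \near \oo, jump_step (- eta k t phi) z = jump_step (- eta k (s n) (psi n)) z.
    by move=> /near_eq_cvg/cvg_trans; apply; exact: cvg_cst.
  have [z0|z0] := eqVneq z 0; first by apply: nearW => n; rewrite /jump_step z0 eqxx !orbT.
  have [zr'|zr'] := eqVneq z (- r).
    apply: nearW => n; rewrite /jump_step (negbTE z0) !orbF zr'.
    by rewrite !ltrN2 !ltNge; have /andP[_ ->] := eb (s n) _ (ipsi n); have /andP[_ ->] := eb t _ iphi.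
  have zk : z != - eta k t phi.
    by case: ot => [/eqP|[/eqP|/(_ k)//]]; rewrite ?(negbTE z0) ?(negbTE zr').
  (* Once the moving jump is closer to its limit than [z] is, it lies on the same side of [z] as the
     limit. *)
  have d0 : 0 < `|z + eta k t phi|.
    by rewrite normr_gt0 addr_eq0.
  move/cvgrPdist_lt : ecv => /(_ _ d0) H.
  apply: filterS H => n; rewrite /jump_step (negbTE z0) !orbF.
  set p1 := eta k t phi; set p2 := eta k (s n) (psi n) => H1.
  suff -> : (- p1 < z) = (- p2 < z) by [].
  move: H1; rewrite ltr_norml => /andP[H1 H2].
  move: H1 H2; have [zp|zp] := leP 0 (z + p1) => H1 H2.
    rewrite (ger0_norm zp) in H1 H2.
    have z1 : 0 < z + p1 by rewrite lt_neqAle zp andbT eq_sym addr_eq0.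
    by apply/idP/idP; lra.
  by rewrite (ltr0_norm zp) in H1 H2; apply/idP/idP; lra.
have [K0 K00 HK0] := within_continuous_bounded iphi.
(* One bounded set contains the limit and the entire sequence, as all distances are below 1; hence a
   single truncation index [N] serves every [n]. *)
pose K := K0 + `|t| + 1.
have n1 n : n.+1%:R^-1 <= 1 :> R by rewrite invf_le1 // ler1n.
have t0 := normr_ge0 t.
have bK n : boundedC r (psi n) K.
  move=> th thr; have := lt_le_trans (ball n th thr) (n1 n); have := HK0 th thr.
  have := lerB_dist (psi n th) (phi th); rewrite /K; lra.
have sK n : `|s n| <= K.
  have := lt_le_trans (st n) (n1 n); have := lerB_dist (s n) t; rewrite /K; lra.
have btK : boundedC r phi K by move=> th /HK0; rewrite /K; lra.
have tK : `|t| <= K by rewrite /K; lra.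
apply/cvgrPdist_lt => e e0.
have [N HN] := tail K (e / 4) ltac:(by rewrite divr_gt0).
have trunc t' phi' l : inC r phi' -> `|t'| <= K -> boundedC r phi' K ->
  (fun n => \sum_(k < n) h k t' phi' * jump_step (- eta k t' phi') z) @ \oo --> l ->
  `|l - \sum_(k < N) h k t' phi' * jump_step (- eta k t' phi') z| <= e / 4.
  move=> i' k' b' /cvgrPdist_le cl; apply/ler_addgt0Pr => e' e'0.
  near \oo => M.
  have Nlem : (N <= M)%N by near: M; exact: nbhs_infty_ge.
  have h1 : `|l - \sum_(k < M) h k t' phi' * jump_step (- eta k t' phi') z| <= e'.
    by near: M; exact: cl.
  have h2 : `|\sum_(k < M) h k t' phi' * jump_step (- eta k t' phi') z -
      \sum_(k < N) h k t' phi' * jump_step (- eta k t' phi') z| <= e / 4.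
    rewrite -!(big_mkord xpredT (fun k => h k t' phi' * jump_step (- eta k t' phi') z)).
    rewrite (big_cat_nat (leq0n N) Nlem) /= [X in `|X - _|]addrC addrK.
    apply: le_trans (HN N M t' phi' i' (leqnn N) k' b').
    apply: (le_trans (ler_norm_sum _ _ _)); apply: ler_sum => k _.
    rewrite normrM ler_piMr // /jump_step; case: ifP => _; rewrite ?normr1 ?normr0 //.
  set S1 := \sum_(k < M) _ in h1 h2; set S2 := \sum_(k < N) _ in h2 *.
  have := ler_distD S1 l S2; lra.
have : (fun n => \sum_(k < N) h k (s n) (psi n) * jump_step (- eta k (s n) (psi n)) z)
    @ \oo --> \sum_(k < N) h k t phi * jump_step (- eta k t phi) z.
  by apply: (@cvg_sum_ord R R _ _ _ N
    (fun k n => h k (s n) (psi n) * jump_step (- eta k (s n) (psi n)) z)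
    (fun k => h k t phi * jump_step (- eta k t phi) z)) => k _; exact: jc.
move=> /cvgrPdist_lt/(_ (e / 4) ltac:(by rewrite divr_gt0)) H.
apply: filterS H => n; rewrite /= => H.
have h1 := trunc _ _ _ iphi tK btK gdt.
have h2 := trunc _ _ _ (ipsi n) (sK n) (bK n) (gdn n).
move: H h1 h2; set S1 := \sum_(k < N) _; set S2 := \sum_(k < N) _.
set l1 := _ - gc z t phi; set l2 := _ - gc z (s n) (psi n) => H h1 h2.
have := ler_distD S1 l1 l2; have := ler_distD S2 S1 l2.
rewrite (distrC S2 l2); lra.
Unshelve. all: by end_near. Qed.

End Jumps.

(** A failure of continuity yields a sequence converging to (t, phi) along which the integral stays
    away from its limit. Only countably many jump points occur along it, so Helly's theorem applies
    and contradicts this. *)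
Lemma Fnl_continuous {X : completeNormedModType R} (r : R) (p : R -> X -> X)
    (g : R -> R -> (R -> X) -> R) (Lp Mvg : R) :
  0 < r -> 0 <= Lp ->
  (forall t u s v, `|p t u - p s v| <= Lp * (`|s - t| + `|u - v|)) ->
  (forall t phi, inC r phi ->
     bounded_variation (-r) 0 (fun th => g th t phi) /\
     (total_variation (-r) 0 (fun th => g th t phi) <= Mvg%:E)%E) ->
  (exists (gc : R -> R -> (R -> X) -> R) (eta h : nat -> R -> (R -> X) -> R),
     jump_decomposition r g gc eta h) ->
  continuous_RC r (Fnl r p g).
Proof.
move=> r0 Lp0 pL bv [gc [eta [h dec]]] t phi iphi e e0; apply: contrapT => H.
have r0' : - r <= 0 by lra.
have /choice[z Hz] : forall n : nat, exists z : R * (R -> X), [/\ inC r z.2,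
    `|z.1 - t| < n.+1%:R^-1, ballC r phi n.+1%:R^-1 z.2 &
    ~ `|Fnl r p g z.1 z.2 - Fnl r p g t phi| < e].
  move=> n; apply: contrapT => Hn; apply: H; exists n.+1%:R^-1; first by rewrite invr_gt0.
  by move=> s psi ipsi st ball; apply: contrapT => nlt; apply: Hn; exists (s, psi).
pose s n := (z n).1; pose psi n := (z n).2.
have ipsi n : inC r (psi n) by have [] := Hz n.
have st n : `|s n - t| < n.+1%:R^-1 by have [] := Hz n.
have ball n : ballC r phi n.+1%:R^-1 (psi n) by have [] := Hz n.
have far n : ~ `|Fnl r p g (s n) (psi n) - Fnl r p g t phi| < e by have [] := Hz n.
have ucp t' phi' : inC r phi' -> unif_cont_on (-r) 0 (fun th => p t' (phi' th)).
  move=> /Heine_Cantor uc e' e'0.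
  have L1 : 0 < Lp + 1 by lra.
  have [d d0 Hd] := uc (e' / (Lp + 1)) ltac:(by rewrite divr_gt0).
  exists d => // x y xr yr xy; apply: (le_lt_trans (pL _ _ _ _)).
  rewrite subrr normr0 add0r.
  have := Hd x y xr yr xy; rewrite ltr_pdivlMr // mulrDr mulr1 mulrC.
  by apply: le_lt_trans; rewrite lerDl.
have [v domv vV] := total_variation_dominated r0' (bv t phi iphi).1 (bv t phi iphi).2.
have /choice[vn Hvn] : forall n, exists v, dominated_on (-r) 0 (fun th => g th (s n) (psi n)) v
    /\ v 0 - v (- r) <= Mvg.
  move=> n; have [b1 b2] := bv (s n) (psi n) (ipsi n).
  by have [w w1 w2] := total_variation_dominated r0' b1 b2; exists w.
(* [None] stands for the limit (t, phi) and [Some n] for the n-th term, so that [E] collects all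
   jump points in a single countable range. *)
pose sig (o : option nat) := if o is Some n then z n else (t, phi).
pose E := range (fun o : option nat * nat => - eta o.2 (sig o.1).1 (sig o.1).2).
have cE : countable E by apply: sub_countable (card_image_le _ _) (countableP _).
pose q th := p t (phi th).
(* The integrator moves first, with the integrand frozen at the limit; the integrand is changed
   afterwards, at a cost proportional to [Lp * (dn + dn) * Mvg] by the Lipschitz bound on [p]. *)
have cv : (fun n => RS_integral q (fun th => g th (s n) (psi n)) (-r) 0) @ \oo -->
    RS_integral q (fun th => g th t phi) (-r) 0.
  apply: (@RS_integral_cvg _ _ (-r) 0 Mvg q _ vn _ v
    (fun x => -r <= x <= 0 /\ (x = -r \/ x = 0 \/ ~ E x))) => //.
  - lra.
  - exact: ucp.
  - by move=> n; have [] := Hvn n.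
  - by move=> n; have [] := Hvn n.
  - by split; [lra|left].
  - by split; [lra|right; left].
  - move=> lo hi lo1 lohi hi0; have [x nE xl] := countable_avoid cE lohi.
    by exists x => //; split; [lra|right; right].
  - move=> x [xr xE]; apply: (jump_cvg dec) => //.
      case: xE => [|[|nE]]; [by left|by right; left|right; right => k].
      by apply/eqP => xk; apply: nE; exists (None, k).
    move=> n; case: xE => [|[|nE]]; [by left|by right; left|right; right => k].
    by apply/eqP => xk; apply: nE; exists (Some n, k).
have M0 : 0 <= Mvg.
  by apply: le_trans vV; exact: le_trans (domv (-r) 0 _ r0' _).
have c0 : 0 < Lp * 2 * Mvg + 1 by have := mulr_ge0 Lp0 M0; lra.
move/cvgrPdist_lt : cv => /(_ (e / 2) ltac:(by rewrite divr_gt0)) cv.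
near \oo => n; apply: (far n).
have h1 : `|RS_integral q (fun th => g th t phi) (-r) 0 -
    RS_integral q (fun th => g th (s n) (psi n)) (-r) 0| < e / 2 by near: n.
have nd : n.+1%:R^-1 < e / 2 / (Lp * 2 * Mvg + 1).
  near: n; apply: (near_infty_natSinv_lt (PosNum _)); by rewrite !divr_gt0.
have [domn vnV] := Hvn n.
pose dn : R := n.+1%:R^-1.
have dn0 : 0 < dn by rewrite invr_gt0.
have h2 : `|Fnl r p g (s n) (psi n) - RS_integral q (fun th => g th (s n) (psi n)) (-r) 0|
    <= Lp * (dn + dn) * (vn n 0 - vn n (- r)).
  apply: (RS_integral_dist r0' domn _ _ (RS_integrable r0' domn (ucp _ _ (ipsi n)))
     (RS_integrable r0' domn (ucp _ _ iphi))); first by rewrite mulr_ge0 //; lra.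
  move=> th thr; apply: (le_trans (pL _ _ _ _)); rewrite ler_wpM2l // distrC.
  by apply: lerD; apply: ltW; [exact: st|exact: ball].
have h3 : Lp * (dn + dn) * (vn n 0 - vn n (- r)) <= Lp * (dn + dn) * Mvg.
  by rewrite ler_wpM2l // mulr_ge0 //; lra.
have h4 : Lp * (dn + dn) * Mvg < e / 2.
  by move: nd; rewrite -/dn ltr_pdivlMr //; lra.
rewrite -/(Fnl r p g t phi) in h1.
have := ler_distD (RS_integral q (fun th => g th (s n) (psi n)) (-r) 0)
  (Fnl r p g (s n) (psi n)) (Fnl r p g t phi).
rewrite (distrC (RS_integral _ _ _ _) (Fnl r p g t phi)).
move: h1 (le_lt_trans h2 (le_lt_trans h3 h4)); lra.
Unshelve. all: by end_near. Qed.

Lemma Bnl_continuous {X : normedModType R} (r : R) (G : R -> X -> X -> X)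
    (p : R -> X -> X) (g : R -> R -> (R -> X) -> R) : 0 <= r ->
  continuous (fun z : R * (X * X) => G z.1 z.2.1 z.2.2) ->
  continuous_RC r (Fnl r p g) -> continuous_RC r (Bnl r G p g).
Proof.
move=> r0 Gc Fc t phi iphi e e0.
have := Gc (t, (phi 0, Fnl r p g t phi)).
move=> /cvgrPdist_lt/(_ e e0)/nbhs_ballP[d /= d0 Hd].
have [d1 d10 H1] := Fc t phi iphi d d0.
exists (Num.min d d1); first by rewrite lt_min d0.
move=> s psi ipsi; rewrite lt_min => /andP[sd sd1] ball.
rewrite distrC; apply: (Hd (s, (psi 0, Fnl r p g s psi))).
have b1 : `|psi 0 - phi 0| < d.
  by have := ball 0 ltac:(lra); rewrite lt_min => /andP[].
have b2 : `|Fnl r p g s psi - Fnl r p g t phi| < d.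
  by apply: H1 => // th thr; have := ball th thr; rewrite lt_min => /andP[].
by split; [|split]; rewrite -ball_normE /ball_ /= distrC.
Qed.

End Nonlinearity.

(** * Convolution with a compact semigroup *)

Lemma continuous_unif_cont_on {R : realType} {X : normedModType R} (a b : R)
    (f : R -> X) : continuous f -> unif_cont_on a b f.
Proof. by move=> fc; apply: Heine_Cantor; exact: continuous_subspaceT. Qed.

Lemma unif_cont_on_continuous {R : realType} {X : normedModType R} (f : R -> X) :
  (forall a b, unif_cont_on a b f) -> continuous f.
Proof.
move=> uc x; apply/cvgrPdist_lt => e e0; have [d d0 Hd] := uc (x - 1) (x + 1) e e0.
apply/nbhs_ballP; exists (Num.min d 1) => /=; first by rewrite lt_min d0 ltr01.
move=> y /= xy; have : `|x - y| < Num.min d 1 := xy.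
rewrite lt_min => /andP[{}xy].
rewrite ltr_norml => xy1; apply: Hd => //; lra.
Qed.

(** If no point of [K] is a limit, the ultrafilter property gives each one a ball that [u]
    eventually avoids. By compactness [u i] eventually differs from every point of [K], including
    itself. *)
Lemma compact_ultra_cvg {R : realType} {X : normedModType R} (I : Type)
    (U : set_system I) (K : set X) (u : I -> X) : UltraFilter U ->
  compact K -> (forall i, K (u i)) -> exists x : X, u @ U --> x.
Proof.
move=> UU cK uK; apply: contrapT => H.
have PU : ProperFilter U by exact: ultra_proper.
have : \near U, K `<=` (fun x => u U <> x).
  move/compact_near_coveringP : cK => /(_ I U (fun i x => u i <> x)); apply => x Kx.
  have [e e0 nU] : exists2 e, 0 < e & ~ U [set i | `|x - u i| < e].
    apply: contrapT => He; apply: H; exists x; apply/cvgrPdist_lt => e e0.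
    by apply: contrapT => nU; apply: He; exists e.
  have [//|CU] := in_ultra_setVsetC [set i | `|x - u i| < e] UU.
  exists (ball x e, ~` [set i | `|x - u i| < e]).
    by split => //=; exact: nbhsx_ballx.
  by move=> [y i] /= [+ ni] uy; rewrite -ball_normE -uy; exact: ni.
move=> HU; near U => i.
have : K `<=` (fun x => u i <> x) by near: i.
by move=> /(_ (u i) (uK i)).
Unshelve. all: by end_near. Qed.

Section Semigroup.
Context {R : realType} {X : completeNormedModType R} (S : R -> X -> X) (w : R).
Hypothesis HS : compact_C0_semigroup S w.
Implicit Types (a t s T M e eps h : R) (x y z : X) (f : R -> X).

Lemma semigroupP t (c : R) x y : 0 <= t -> S t (c *: x + y) = c *: S t x + S t y.
Proof. by have [H _ _ _ _] := HS => t0; exact: H. Qed.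

Lemma semigroup0 x : S 0 x = x.
Proof. by have [_ [H _] _ _ _] := HS. Qed.

Lemma semigroupD t s x : 0 <= t -> 0 <= s -> S (t + s) x = S t (S s x).
Proof. by have [_ [_ H] _ _ _] := HS => t0 s0; exact: H. Qed.

Lemma semigroupB t x y : 0 <= t -> S t (x - y) = S t x - S t y.
Proof. by move=> t0; rewrite -scaleN1r addrC semigroupP // scaleN1r addrC. Qed.

Lemma semigroupZ t (c : R) x : 0 <= t -> S t (c *: x) = c *: S t x.
Proof.
move=> t0; rewrite -[c *: x]addr0 semigroupP //.
have -> : S t 0 = 0 by rewrite -[X in S t X](subrr 0) semigroupB // subrr.
by rewrite addr0.
Qed.

Lemma semigroupDr t x y : 0 <= t -> S t (x + y) = S t x + S t y.
Proof. by move=> t0; rewrite -[x]scale1r semigroupP // !scale1r. Qed.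

(** With [|w|] in place of [w] the bound increases in time, so one constant covers [0, T] whatever
    the sign of [w]. *)
Lemma semigroup_norm T t x : 0 <= t <= T -> `|S t x| <= expR (`|w| * T) * `|x|.
Proof.
move=> /andP[t0 tT]; have [_ _ _ H _] := HS.
apply: (le_trans (H t t0 x)); rewrite ler_wpM2r // ler_expR.
apply: (@le_trans _ _ (`|w| * t)); first by rewrite ler_wpM2r // ler_norm.
by rewrite ler_wpM2l.
Qed.

Lemma expR_normM_ge1 T : 0 <= T -> 1 <= expR (`|w| * T).
Proof. by move=> T0; rewrite -[leLHS]expR0 ler_expR mulr_ge0. Qed.

Lemma semigroup_near0 x e : 0 < e ->
  exists2 d, 0 < d & forall h, 0 <= h < d -> `|S h x - x| < e.
Proof.
move=> e0; have [_ _ H _ _] := HS.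
have /cvgrPdist_lt/(_ e e0) := H x.
rewrite near_withinE => /nbhs_ballP[d /= d0 Hd]; exists d => // h /andP[h0 hd].
move: h0; rewrite le_eqVlt => /predU1P[<-|h0]; first by rewrite semigroup0 subrr normr0.
have bh : `|0 - h| < d by rewrite sub0r normrN gtr0_norm.
by rewrite distrC; exact: Hd bh h0.
Qed.

(** For s <= t the increment is [S s] applied to [S (t - s) x - x], so right continuity at 0 yields
    a two-sided modulus. *)
Lemma semigroup_unif_cont T x : 0 <= T -> unif_cont_on 0 T (S ^~ x).
Proof.
move=> T0 e e0; pose E := expR (`|w| * T).
have E0 : 0 < E by exact: expR_gt0.
have [d d0 Hd] := semigroup_near0 x (divr_gt0 e0 E0).
have le_case s t : 0 <= s <= T -> s <= t -> `|s - t| < d -> `|S s x - S t x| < e.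
  move=> sT st; rewrite distrC ger0_norm ?subr_ge0 // => dd.
  have -> : S t x = S s (S (t - s) x) by rewrite -semigroupD ?subrKC //; lra.
  rewrite -semigroupB; last by lra.
  apply: (le_lt_trans (semigroup_norm _ sT)).
  rewrite -/E -ltr_pdivlMl // mulrC distrC; apply: Hd; lra.
exists d => // s t sT tT st; have [ab|/ltW] := leP s t; first exact: le_case.
by move=> ts; rewrite distrC; apply: le_case => //; rewrite distrC.
Qed.

(** Pointwise convergence of [S h] to the identity is uniform on compact sets, since the [S h] are
    uniformly bounded. It is applied on the closure of the image of the unit ball, and scaled by
    [M]. *)
Lemma semigroup_smoothing eps M e : 0 < eps -> 0 < M -> 0 < e ->
  exists2 d, 0 < d & forall h z, 0 <= h < d -> `|z| <= M ->
    `|S h (S eps z) - S eps z| <= e.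
Proof.
move=> eps0 M0 e0; have [_ _ _ _ cS] := HS.
have e10 : 0 < e / M by rewrite divr_gt0.
pose E := expR (`|w| * 1).
have E1 : 1 <= E by exact: expR_normM_ge1.
have : \forall h \near 0^'+, closure [set S eps x | x in [set x | `|x| <= 1]] `<=`
    (fun x => `|S h x - x| <= e / M).
  have /compact_near_coveringP := cS eps eps0.
  move=> /(_ R (0^'+) (fun h x => `|S h x - x| <= e / M)); apply => x _.
  have e20 : 0 < e / M / 2 by rewrite divr_gt0.
  (* Passing from [x] to a neighbour [y] costs [E * |x - y|] inside [S h] and [|x - y|] outside,
     hence the factor [E + 1]. *)
  have d10 : 0 < e / M / 2 / (E + 1) by rewrite divr_gt0 //; lra.
  have [d d0 Hd] := semigroup_near0 x e20.
  exists (ball x (e / M / 2 / (E + 1)), [set h | 0 < h /\ h < d /\ h < 1]).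
    split => /=; first exact: nbhsx_ballx.
    near=> h; split; first by near: h; exact: nbhs_right_gt.
    by split; near: h; exact: nbhs_right_lt.
  move=> [y h] /= [+ [h0 [hd h1]]]; rewrite -ball_normE /ball_ /= => xy.
  have a1 : `|S h x - x| < e / M / 2 by apply: Hd; lra.
  have a2 : `|S h y - S h x| <= E * `|x - y|.
    rewrite -semigroupB ?(ltW h0) // (distrC x); apply: semigroup_norm; lra.
  have a3 : `|x - y| * (E + 1) < e / M / 2 by rewrite -ltr_pdivlMr //; lra.
  have := ler_distD (S h x) (S h y) y; have := ler_distD x (S h x) y.
  lra.
rewrite near_withinE => /nbhs_ballP[d /= d0 Hd]; exists d => // h z /andP[h0 hd] zM.
move: h0; rewrite le_eqVlt => /predU1P[<-|h0]; first by rewrite semigroup0 subrr normr0 ltW.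
have bh : `|0 - h| < d by rewrite sub0r normrN gtr0_norm.
suff H y : `|y| <= 1 -> `|S h (S eps (M *: y)) - S eps (M *: y)| <= e.
  have := H (M^-1 *: z); rewrite scalerA divff ?gt_eqF // scale1r; apply.
  by rewrite normrZ gtr0_norm ?invr_gt0 // mulrC ler_pdivrMr // mul1r.
move=> y1; rewrite !semigroupZ ?(ltW h0) ?(ltW eps0) // -scalerBr normrZ.
rewrite gtr0_norm // mulrC -ler_pdivlMr //; apply: (Hd h bh h0).
by apply: subset_closure; exists y.
Unshelve. all: by end_near. Qed.

(** The Duhamel integral, written with the integrator [id] so that the Stieltjes estimates apply
    with [v] equal to [id]. *)
Definition sconv (a : R) (f : R -> X) (t : R) : X :=
  RS_integral (fun s => S (t - s) (f s)) id a t.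

Lemma id_dominated_on (a b : R) : dominated_on a b id id.
Proof. by move=> s t _ st _; rewrite /= ger0_norm ?subr_ge0. Qed.

Lemma sconv_integral a f t : a <= t -> continuous f ->
  is_R_integral (fun s => S (t - s) (f s)) a t (sconv a f t).
Proof.
move=> at_ fc; rewrite /is_R_integral /sconv.
apply: (@RS_integrable _ _ a t _ id id at_ (@id_dominated_on a t)).
apply: Heine_Cantor; apply/within_continuousP => x xat e e0.
pose E := expR (`|w| * (t - a)).
have E0 : 0 < E by exact: expR_gt0.
have e20 : 0 < e / 2 by rewrite divr_gt0.
have [d d0 Hd] := semigroup_unif_cont (f x) (ltac:(lra) : 0 <= t - a) e20.
have [d1 d10 Hd1] := continuous_unif_cont_on a t fc (divr_gt0 e20 E0).
exists (Num.min d d1); first by rewrite lt_min d0.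
move=> y yat; rewrite lt_min => /andP[xyd xyd1].
have h1 : `|S (t - x) (f x) - S (t - y) (f x)| < e / 2.
  apply: Hd; [lra|lra|].
  have -> : t - x - (t - y) = - (x - y) by ring.
  by rewrite normrN.
have h2 : `|S (t - y) (f x) - S (t - y) (f y)| < e / 2.
  rewrite -semigroupB; last by lra.
  have ty : 0 <= t - y <= t - a by lra.
  apply: (le_lt_trans (semigroup_norm _ ty)); rewrite -/E mulrC -ltr_pdivlMr //.
  exact: Hd1.
have := ler_distD (S (t - y) (f x)) (S (t - x) (f x)) (S (t - y) (f y)); lra.
Qed.

Lemma sconv_dist T M a f1 f2 t : a <= t <= a + T -> continuous f1 -> continuous f2 ->
  0 <= M -> (forall s, a <= s <= t -> `|f1 s - f2 s| <= M) ->
  `|sconv a f1 t - sconv a f2 t| <= expR (`|w| * T) * M * (t - a).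
Proof.
move=> /andP[at_ tT] c1 c2 M0 H.
apply: (RS_integral_dist at_ (@id_dominated_on a t) _ _ (sconv_integral at_ c1)
  (sconv_integral at_ c2)); first by rewrite mulr_ge0 // expR_ge0.
move=> s sat; rewrite -semigroupB; last by lra.
apply: (le_trans (@semigroup_norm T (t - s) _ _)); first by lra.
by rewrite ler_wpM2l ?expR_ge0 // H.
Qed.

Lemma sconv_norm T M a f t : a <= t <= a + T -> continuous f ->
  0 <= M -> (forall s, a <= s <= t -> `|f s| <= M) ->
  `|sconv a f t| <= expR (`|w| * T) * M * (t - a).
Proof.
move=> /andP[at_ tT] fc M0 H; rewrite -[sconv _ _ _]subr0.
apply: (RS_integral_dist at_ (@id_dominated_on a t) _ _ (sconv_integral at_ fc)
  (@is_RS_integral0 _ _ a t id)); first by rewrite mulr_ge0 // expR_ge0.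
move=> s sat; rewrite subr0.
apply: (le_trans (@semigroup_norm T (t - s) _ _)); first by lra.
by rewrite ler_wpM2l ?expR_ge0 // H.
Qed.

Lemma sconv_xx a f : continuous f -> sconv a f a = 0.
Proof.
move=> fc; apply/eqP; rewrite -normr_le0.
have aa : a <= a <= a + 0 by rewrite addr0 lexx.
have := @sconv_norm 0 `|f a| a f a aa fc (normr_ge0 _).
rewrite subrr mulr0; apply => s /andP[h1 h2].
by have -> : s = a by apply/eqP; rewrite eq_le h2.
Qed.

Lemma eq_sconv a f1 f2 t : a <= t -> continuous f1 -> continuous f2 ->
  (forall s, a <= s <= t -> f1 s = f2 s) -> sconv a f1 t = sconv a f2 t.
Proof.
move=> at_ c1 c2 H; apply/eqP; rewrite -subr_eq0 -normr_le0.
have tt : a <= t <= a + (t - a) by lra.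
have := @sconv_dist (t - a) 0 a f1 f2 t tt c1 c2 (lexx _).
by rewrite mulr0 mul0r; apply => s /H ->; rewrite subrr normr0.
Qed.

(** Before [t] the kernel factors as [S (t' - t)] after [S (t - s)], and the bounded operator
    [S (t' - t)] commutes with the integral. *)
Lemma sconv_split a f t t' : a <= t -> t <= t' -> continuous f ->
  sconv a f t' = S (t' - t) (sconv a f t) + sconv t f t'.
Proof.
move=> at_ tt' fc.
have h0 : 0 <= t' - t by lra.
apply: (RS_integral_cat at_ tt' _ (sconv_integral tt' fc)
  (sconv_integral (le_trans at_ tt') fc)).
have hh : 0 <= t' - t <= t' - t by lra.
have := @is_RS_integral_comp _ _ a t (fun s => S (t - s) (f s)) id (sconv a f t)
  (S (t' - t)) _ (expR_ge0 _) (fun c x y => semigroupP c x y h0)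
  (fun x => semigroup_norm x hh) (sconv_integral at_ fc).
apply: eq_is_RS_integral => s sat; rewrite -semigroupD //; last by lra.
by congr S; lra.
Qed.

(* Away from the last [eps] units of time, the convolution lies in the image under the
   compact operator [S eps] of a bounded set. *)
Lemma sconv_compact_part T M a f t eps : 0 <= M -> 0 < eps -> a <= t - eps -> t <= a + T ->
  continuous f -> (forall s, a <= s <= t -> `|f s| <= M) ->
  [/\ `|sconv a f (t - eps)| <= expR (`|w| * T) * M * T,
      sconv a f t = S eps (sconv a f (t - eps)) + sconv (t - eps) f t &
      `|sconv (t - eps) f t| <= expR (`|w| * T) * M * eps].
Proof.
move=> M0 eps0 ateps tT fc H; have E0 := expR_ge0 (`|w| * T).
have EM0 := mulr_ge0 E0 M0; split.
- have h : a <= t - eps <= a + T by lra.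
  apply: (le_trans (sconv_norm h fc M0 _)); first by move=> s sat; apply: H; lra.
  by rewrite ler_wpM2l //; lra.
- rewrite (@sconv_split a f (t - eps) t) //; last by lra.
  by congr (S _ _ + _); lra.
- have h : t - eps <= t <= t - eps + T by lra.
  apply: (le_trans (sconv_norm h fc M0 _)); first by move=> s sat; apply: H; lra.
  by rewrite ler_wpM2l //; lra.
Qed.

(** The increment is a short integral plus [S (t' - t) x - x] with [x] the convolution at [t].
    Strong continuity alone is not uniform over such [x]; it becomes so on the part of [x] in the
    range of [S eps], and the remainder of [x] has norm at most [E * M * eps]. *)
Lemma sconv_equicontinuous T M a e : 0 < T -> 0 < M -> 0 < e ->
  exists2 d, 0 < d & forall f, continuous f ->
    (forall s, a <= s <= a + T -> `|f s| <= M) ->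
    forall t t', a <= t <= a + T -> a <= t' <= a + T -> `|t - t'| < d ->
    `|sconv a f t - sconv a f t'| < e.
Proof.
move=> T0 M0 e0; pose E := expR (`|w| * T).
have E1 : 1 <= E by exact/expR_normM_ge1/ltW.
have EM0 : 0 < E * M by rewrite mulr_gt0 //; lra.
have e40 : 0 < e / 4 by rewrite divr_gt0.
have c0 : 0 < (E + 1) * (E * M) by rewrite mulr_gt0 //; lra.
(* Chosen so that [S h x - x] is at most [e / 4] whenever [x] has norm at most [E * M * eps]. *)
pose eps := e / 4 / ((E + 1) * (E * M)).
have eps0 : 0 < eps by rewrite divr_gt0.
have epsE : (E + 1) * (E * M * eps) = e / 4.
  by rewrite [LHS]mulrA mulrC /eps divfK // gt_eqF.
have [d1 d10 Hd1] := semigroup_smoothing eps0 (mulr_gt0 EM0 T0) e40.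
pose d := Num.min d1 (e / 4 / (E * M)).
have d0 : 0 < d by rewrite lt_min d10 divr_gt0.
exists d => // f fc fM.
have le_case t t' : a <= t <= a + T -> t' <= a + T -> t <= t' -> `|t - t'| < d ->
    `|sconv a f t - sconv a f t'| < e.
  move=> taT t'T tt'; rewrite distrC ger0_norm ?subr_ge0 // lt_min => /andP[hd1 hd2].
  have h0 : 0 <= t' - t <= T by lra.
  rewrite (sconv_split _ tt' fc); last by lra.
  have n1 : `|sconv t f t'| < e / 4.
    have tt'T : t <= t' <= t + T by lra.
    apply: (le_lt_trans (sconv_norm tt'T fc (ltW M0) _)).
      by move=> s st; apply: fM; lra.
    by rewrite -/E mulrC -ltr_pdivlMr.
  have small x : `|x| <= E * M * eps -> `|S (t' - t) x - x| <= e / 4.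
    move=> xs; rewrite -epsE mulrDl mul1r; apply: (le_trans (ler_normB _ _)).
    apply: lerD => //; apply: (le_trans (semigroup_norm _ h0)).
    by rewrite -/E ler_wpM2l //; lra.
  have n2 : `|S (t' - t) (sconv a f t) - sconv a f t| <= e / 2.
    (* If [t] is too close to [a] for a cut at [t - eps], the whole convolution is as small as the
       part cut off. *)
    have [te|te] := leP t (a + eps).
      apply: (@le_trans _ _ (e / 4)); last by lra.
      apply: small; apply: (le_trans (sconv_norm taT fc (ltW M0) _)).
        by move=> s st; apply: fM; lra.
      by rewrite -/E ler_pM2l //; lra.
    have [||||b1 b2 b3] := @sconv_compact_part T M a f t eps (ltW M0) eps0.
    - lra.
    - lra.
    - exact: fc.
    - by move=> s st; apply: fM; lra.
    have s1 : `|S (t' - t) (S eps (sconv a f (t - eps))) - S eps (sconv a f (t - eps))| <= e / 4.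
      by apply: Hd1 => //; lra.
    have s2 := small _ b3.
    rewrite b2 semigroupDr; last by lra.
    rewrite opprD addrACA; apply: (le_trans (ler_normD _ _)); lra.
  rewrite distrC addrAC; apply: (le_lt_trans (ler_normD _ _)); lra.
move=> t t' taT t'aT tt'; have [h|/ltW h] := leP t t'; first by apply: le_case => //; lra.
by rewrite distrC; apply: le_case => //; [lra|rewrite distrC].
Qed.

(** For each eps the truncated convolution, scaled by [M'], stays in a compact set and converges
    along [U]. Its limit approximates the full convolution within [e], which the Cauchy criterion
    turns into convergence. *)
Lemma sconv_ultra_cvg T M a t (I : Type) (U : set_system I) (f : I -> R -> X) :
  UltraFilter U -> 0 < M -> a <= t <= a + T -> (forall i, continuous (f i)) ->
  (forall i s, a <= s <= a + T -> `|f i s| <= M) ->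
  cvg ((fun i => sconv a (f i) t) @ U).
Proof.
move=> UU M0 /andP[at_ tT] fc fM.
have PU : ProperFilter U by exact: ultra_proper.
move: at_; rewrite le_eqVlt => /predU1P[<-|at_].
  rewrite (_ : (fun _ => _) = fun=> 0); first exact: is_cvg_cst.
  by apply/funext => i; exact: sconv_xx.
pose E := expR (`|w| * T).
have E0 : 0 < E by exact: expR_gt0.
have EM0 : 0 < E * M by rewrite mulr_gt0.
apply: cvg_of_near_approx => e e0.
have e20 : 0 < e / 2 by rewrite divr_gt0.
(* The first bound keeps the cut at or after [a], the second makes the part cut off at most
   [e / 2]. *)
pose eps := Num.min (t - a) (e / 2 / (E * M)).
have eps0 : 0 < eps by rewrite lt_min subr_gt0 at_ divr_gt0.
have epsE : E * M * eps <= e / 2.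
  by rewrite mulrC -ler_pdivlMr // ge_min lexx orbT.
have ateps : a <= t - eps.
  have : eps <= t - a by rewrite ge_min lexx.
  lra.
have part i := @sconv_compact_part T M a (f i) t eps (ltW M0) eps0 ateps tT (fc i)
  (fun s (st : a <= s <= t) => fM i s ltac:(lra)).
have T0 : 0 < T by lra.
pose M' := E * M * T.
have M'0 : 0 < M' by rewrite mulr_gt0.
have [_ _ _ _ cS] := HS.
have [k kcvg] : exists k : X, (fun i => S eps (M'^-1 *: sconv a (f i) (t - eps))) @ U --> k.
  apply: (compact_ultra_cvg UU (cS eps eps0)) => i; apply: subset_closure.
  exists (M'^-1 *: sconv a (f i) (t - eps)) => //=; have [b1 _ _] := part i.
  by rewrite normrZ gtr0_norm ?invr_gt0 // mulrC ler_pdivrMr // mul1r.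
exists (M' *: k).
have /cvgrPdist_lt/(_ (e / 2 / M') ltac:(by rewrite divr_gt0)) := kcvg.
apply: filterS => i ki; have [_ -> b3] := part i.
have h1 : `|M' *: k - S eps (sconv a (f i) (t - eps))| < e / 2.
  move: ki; rewrite semigroupZ ?(ltW eps0) // => ki.
  have -> : S eps (sconv a (f i) (t - eps)) = M' *: (M'^-1 *: S eps (sconv a (f i) (t - eps))).
    by rewrite scalerA divff ?scale1r // gt_eqF.
  rewrite -scalerBr normrZ.
  by rewrite gtr0_norm // mulrC -ltr_pdivlMr.
rewrite opprD addrA; apply: (le_lt_trans (ler_normB _ _)).
rewrite -/E in b3; lra.
Qed.

End Semigroup.

(** * Existence of mild solutions *)

Lemma dist_max_le {R : realType} (c x y : R) :
  `|Num.max c x - Num.max c y| <= `|x - y|.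
Proof.
rewrite ler_norml; have := ler_norm (x - y); have := ler_norm (y - x).
rewrite (distrC y x); have [|] := leP c x; have [|] := leP c y; lra.
Qed.

Lemma dist_min_le {R : realType} (c x y : R) :
  `|Num.min c x - Num.min c y| <= `|x - y|.
Proof.
rewrite ler_norml; have := ler_norm (x - y); have := ler_norm (y - x).
rewrite (distrC y x); have [|] := leP c x; have [|] := leP c y; lra.
Qed.

Section Existence.
Context {R : realType} {X : completeNormedModType R} (S : R -> X -> X) (w : R).
Hypothesis HS : compact_C0_semigroup S w.
Variables (r a : R) (B : R -> (R -> X) -> X) (phi : R -> X).
Hypotheses (r0 : 0 < r) (BC : continuous_RC r B) (iphi : inC r phi).
Implicit Types (u v : R -> X) (t s d e : R).

Let cc := sconv S a.

Lemma seg_inC u t : continuous u -> inC r (seg u t).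
Proof.
move=> uc; apply: continuous_subspaceT => x; apply: continuous_comp; last exact: uc.
by apply: cvgD; [exact: cvg_cst|exact: cvg_id].
Qed.

(** Functions equal on [-r, 0] lie in every ball around each other, so continuity makes [B] depend
    only on the element of C that they represent. *)
Lemma continuous_RC_ext t psi1 psi2 : inC r psi1 -> inC r psi2 ->
  (forall th, - r <= th <= 0 -> psi1 th = psi2 th) -> B t psi1 = B t psi2.
Proof.
move=> i1 i2 H; apply/eqP; rewrite -subr_eq0 -normr_le0.
apply/ler_addgt0Pr => e e0; rewrite add0r; have [d d0 Hd] := BC t i2 e0.
apply/ltW/Hd => //; first by rewrite subrr normr0.
by move=> th /H ->; rewrite subrr normr0.
Qed.

(** Only the state is delayed, not the explicit time; the value 0 of [delta] gives the right-hand
    side of the original equation. *)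
Definition delayed u (delta : R) (s : R) : X := B s (seg u (s - delta)).

Lemma delayed_continuous u delta : continuous u -> continuous (delayed u delta).
Proof.
move=> uc s; apply/cvgrPdist_lt => e e0.
have [d d0 Hd] := BC s (@seg_inC u (s - delta) uc) e0.
have [d1 d10 Hd1] := @continuous_unif_cont_on _ _ (s - delta - r - 1) (s - delta + 1) u uc d d0.
pose d2 := Num.min d (Num.min d1 1).
apply/nbhs_ballP; exists d2 => /=; first by rewrite !lt_min d0 d10 ltr01.
move=> t st; have : `|s - t| < d2 := st; rewrite !lt_min => /and3P[st0 st1 {}st].
rewrite distrC; apply: Hd; [exact: seg_inC|by rewrite distrC|move=> th thr].
move: st; rewrite ltr_norml => st.
apply: Hd1; [lra|lra|].
have -> : t - delta + th - (s - delta + th) = - (s - t) by ring.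
by rewrite normrN.
Qed.

(* the history [phi], frozen left of [a - r] and prolonged by the free evolution *)
Definition free_path (t : R) : X :=
  phi (Num.max (- r) (Num.min 0 (t - a))) + (S (Num.max 0 (t - a)) (phi 0) - phi 0).

Lemma free_path_continuous : continuous free_path.
Proof.
apply: unif_cont_on_continuous => b c e e0.
have e20 : 0 < e / 2 by rewrite divr_gt0.
have [d d0 Hd] := Heine_Cantor iphi e20.
pose T := Num.max 0 (c - a).
have T0 : 0 <= T by rewrite le_max lexx.
have [d1 d10 Hd1] := semigroup_unif_cont HS (phi 0) T0 e20.
exists (Num.min d d1); first by rewrite lt_min d0.
move=> s t sbc tbc; rewrite lt_min => /andP[st st1].
have E : s - a - (t - a) = s - t by ring.
have clampr x : - r <= Num.max (- r) (Num.min 0 x) <= 0.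
  by rewrite le_max lexx /= ge_max ge_min lexx /= andbT oppr_le0 ltW.
have h1 : `|phi (Num.max (- r) (Num.min 0 (s - a))) - phi (Num.max (- r) (Num.min 0 (t - a)))|
    < e / 2.
  apply: Hd => //; apply: (le_lt_trans (dist_max_le _ _ _)).
  by apply: (le_lt_trans (dist_min_le _ _ _)); rewrite E.
have h2 : `|S (Num.max 0 (s - a)) (phi 0) - S (Num.max 0 (t - a)) (phi 0)| < e / 2.
  apply: Hd1.
  - by rewrite le_max lexx /= ge_max T0 /= le_max lerD2r; apply/orP; right; lra.
  - by rewrite le_max lexx /= ge_max T0 /= le_max lerD2r; apply/orP; right; lra.
  - by apply: (le_lt_trans (dist_max_le _ _ _)); rewrite E.
rewrite /free_path opprD addrACA opprB [X in _ + X]addrA subrK.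
apply: (le_lt_trans (ler_normD _ _)); lra.
Qed.

Lemma free_path_history th : - r <= th <= 0 -> free_path (a + th) = phi th.
Proof.
move=> /andP[h1 h2]; rewrite /free_path addrAC subrr add0r (min_r h2) (max_r h1) (max_l h2).
by rewrite (semigroup0 HS) subrr addr0.
Qed.

Lemma free_path_evolution t : a <= t -> free_path t = S (t - a) (phi 0).
Proof.
rewrite -subr_ge0 => h; rewrite /free_path (min_l h) (max_r h) max_r ?oppr_le0 ?ltW //.
by rewrite subrKC.
Qed.

(** Clamping at [a] prolongs the convolution by 0 over the history, which keeps every path
    continuous on the real line. *)
Definition duhamel (f : R -> X) (t : R) : X := cc f (Num.max a t).

Lemma duhamel_le f t : continuous f -> t <= a -> duhamel f t = 0.
Proof. by move=> fc ta; rewrite /duhamel (max_l ta); exact: (sconv_xx HS). Qed.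

Lemma duhamel_continuous f : continuous f -> continuous (duhamel f).
Proof.
move=> fc; apply: unif_cont_on_continuous => b c e e0.
pose T := Num.max 0 (c - a) + 1.
have T0 : 0 < T.
  have : 0 <= Num.max 0 (c - a) by rewrite le_max lexx.
  rewrite /T; lra.
have Tc : c <= a + T.
  have : c - a <= Num.max 0 (c - a) by rewrite le_max lexx orbT.
  rewrite /T; lra.
have [K K0 HK] : exists2 K, 0 <= K & forall x, a <= x <= a + T -> `|f x| <= K.
  by apply: within_continuous_bounded; exact: continuous_subspaceT.
have [|d d0 Hd] := @sconv_equicontinuous _ _ _ _ HS T (K + 1) a e T0 _ e0; first by lra.
exists d => // s t sbc tbc st; apply: (Hd f fc).
- by move=> x /HK; lra.
- by rewrite le_max lexx ge_max; lra.
- by rewrite le_max lexx ge_max; lra.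
- exact: le_lt_trans (dist_max_le _ _ _) st.
Qed.

(** * Solution of the delayed equation by finite iteration *)

Definition tonelli_step (delta : R) v (t : R) : X :=
  free_path t + duhamel (delayed v delta) t.

Definition tonelli delta k := iter k (tonelli_step delta) free_path.

Lemma tonelli_continuous delta k : continuous (tonelli delta k).
Proof.
elim: k => [|k IH]; first exact: free_path_continuous.
move=> t; apply: continuousD; first exact: free_path_continuous.
exact/duhamel_continuous/delayed_continuous.
Qed.

(** The value of a step at [t] depends on [v] only up to [t - delta], so each iteration lengthens by
    [delta] the interval on which the iterates no longer change. *)
Lemma tonelli_stable delta k t : 0 < delta -> t <= a + delta *+ k ->
  tonelli delta k.+1 t = tonelli delta k t.
Proof.
move=> delta0; elim: k t => [|k IH] t.
  rewrite mulr0n addr0 => ta; rewrite /tonelli /= /tonelli_step duhamel_le ?addr0 //.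
  exact/delayed_continuous/free_path_continuous.
rewrite mulrSr addrA => tk; rewrite {1}/tonelli iterS -/(tonelli delta k.+1).
rewrite [RHS]/tonelli iterS -/(tonelli delta k) /tonelli_step; congr (_ + _).
have [ta|ta] := leP t a.
  by rewrite !duhamel_le //; apply/delayed_continuous/tonelli_continuous.
rewrite /duhamel (max_r (ltW ta)); apply: (eq_sconv HS (ltW ta)).
- exact/delayed_continuous/tonelli_continuous.
- exact/delayed_continuous/tonelli_continuous.
move=> s sat; apply: continuous_RC_ext.
- exact/seg_inC/tonelli_continuous.
- exact/seg_inC/tonelli_continuous.
by move=> th thr; apply: IH; lra.
Qed.

(** The bound on [B] requires a path close to [phi], and closeness of the path requires the bound.
    Induction on the iterates breaks the circle: within [d / 4] of the free path [B] is bounded by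
    [M], which keeps the next iterate within [d / 4]. *)
Lemma tonelli_approximation : exists T M delta0, [/\ 0 < T, 0 < M, 0 < delta0, delta0 <= 1 &
  forall delta, 0 < delta -> delta < delta0 -> exists u, [/\ continuous u,
    forall t, t <= a + T -> u t = free_path t + duhamel (delayed u delta) t &
    forall s, a <= s <= a + T -> `|delayed u delta s| <= M]].
Proof.
have [d d0 Hd] := BC a iphi ltr01.
pose M := `|B a phi| + 1.
have M0 : 0 < M by have := normr_ge0 (B a phi); rewrite /M; lra.
have HM s psi : inC r psi -> `|s - a| < d -> ballC r phi d psi -> `|B s psi| <= M.
  move=> i sa ball; have := Hd s psi i sa ball.
  have := lerB_dist (B s psi) (B a phi); rewrite /M; lra.
have d20 : 0 < d / 2 by rewrite divr_gt0.
have [rho rho0 Hrho] := @continuous_unif_cont_on _ _ (a - r - 1) (a + 1) _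
   free_path_continuous _ d20.
pose E := expR (`|w| * 1).
have E0 : 0 < E by exact: expR_gt0.
have EM0 : 0 < E * M by rewrite mulr_gt0.
(* The bounds keep, in order, the time within [d] of [a], the delayed argument within [rho] of the
   history (as [delta < rho]), all arguments in the window where [rho] is valid, and the Duhamel
   term below [d / 4]. *)
pose T := Num.min (Num.min (d / 2) (rho / 2)) (Num.min 1 (d / 4 / (E * M))).
have T0 : 0 < T by rewrite !lt_min d20 ltr01 ?divr_gt0.
have [Td Trho T1 TE] : [/\ T <= d / 2, T <= rho / 2, T <= 1 & T <= d / 4 / (E * M)].
  by split; rewrite !ge_min lexx ?orbT.
have TEM : E * M * T <= d / 4 by rewrite mulrC -ler_pdivlMr.
pose delta0 := Num.min 1 rho.
have delta00 : 0 < delta0 by rewrite lt_min ltr01.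
exists T, M, delta0; split=> //; first by rewrite /delta0 ge_min lexx.
move=> delta delta_gt0; rewrite lt_min => /andP[delta1 deltarho].
have del_bound v : continuous v ->
    (forall t, t <= a + T -> `|v t - free_path t| <= d / 4) ->
    forall s, a <= s <= a + T -> `|delayed v delta s| <= M.
  move=> vc Hv s saT; apply: HM; first exact: seg_inC.
    by rewrite ger0_norm; lra.
  move=> th thr; rewrite /seg -(free_path_history thr).
  have h1 : `|v (s - delta + th) - free_path (s - delta + th)| <= d / 4 by apply: Hv; lra.
  have h2 : `|free_path (s - delta + th) - free_path (a + th)| < d / 2.
    by apply: Hrho; [lra|lra|rewrite ltr_norml; lra].
  have := ler_distD (free_path (s - delta + th)) (v (s - delta + th)) (free_path (a + th)).
  lra.
have bound k t : t <= a + T -> `|tonelli delta k t - free_path t| <= d / 4.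
  elim: k t => [|k IH] t tT; first by rewrite subrr normr0; lra.
  rewrite /tonelli iterS -/(tonelli delta k) /tonelli_step addrC addKr.
  have dc := @delayed_continuous _ delta (@tonelli_continuous delta k).
  have [ta|ta] := leP t a; first by rewrite duhamel_le // normr0; lra.
  rewrite /duhamel (max_r (ltW ta)).
  have t1 : a <= t <= a + 1 by lra.
  apply: (le_trans (sconv_norm HS t1 dc (ltW M0) _)).
    move=> s st; apply: (del_bound _ (@tonelli_continuous delta k)) => //; lra.
  apply: le_trans TEM; rewrite -/E ler_pM2l //; lra.
pose N := (Num.truncn (T / delta)).+1.
have TN : T <= delta *+ N.
  rewrite -mulr_natr mulrC -ler_pdivrMr //; apply/ltW; exact: truncnS_gt.
exists (tonelli delta N); split.
- exact: tonelli_continuous.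
- move=> t tT; rewrite -(@tonelli_stable delta N t) //; lra.
- by move=> s saT; apply: del_bound => //; [exact: tonelli_continuous|exact: bound].
Qed.

(** * Passage to the limit of vanishing delay *)

Theorem mild_solution_exists : exists T, a < T /\ exists u, mild_solution r a T S B phi u.
Proof.
have [T [M [delta0 [T0 M0 delta00 delta01 approx]]]] := tonelli_approximation.
(* The index [n.+2] keeps the delay strictly below [delta0] already for [n] equal to 0. *)
pose delta (n : nat) := delta0 * n.+2%:R^-1.
have delta_gt0 n : 0 < delta n by rewrite mulr_gt0 // invr_gt0.
have delta_lt n : delta n < delta0 by rewrite gtr_pMr // invf_lt1 // ltr1n.
have /choice[un Hun] n := approx (delta n) (delta_gt0 n) (delta_lt n).
have uc n : continuous (un n) by have [] := Hun n.
have uE n : forall t, t <= a + T -> un n t = free_path t + duhamel (delayed (un n) (delta n)) t.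
  by have [] := Hun n.
pose f n := delayed (un n) (delta n).
have fM n : forall s, a <= s <= a + T -> `|f n s| <= M by have [] := Hun n.
have fc n : continuous (f n) by apply: delayed_continuous.
have [U [UU ooU]] := ultraFilterLemma (eventually_filter : ProperFilter \oo).
have PU : ProperFilter U by exact: ultra_proper.
(* Estimates hold on [a, a + T] only; the clamp makes the limit a function on the real line,
   constant outside that segment. *)
pose c t := Num.max a (Num.min (a + T) t).
have c_in t : a <= c t <= a + T.
  by rewrite /c le_max lexx /= ge_max ge_min lexx /= andbT; lra.
have c_id t : a <= t <= a + T -> c t = t.
  by move=> /andP[h1 h2]; rewrite /c (min_r h2) (max_r h1).
have c_dist s t : `|c s - c t| <= `|s - t|.
  exact: le_trans (dist_max_le _ _ _) (dist_min_le _ _ _).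
pose wlim t := lim ((fun n => cc (f n) (c t)) @ U).
have wcvg t : (fun n => cc (f n) (c t)) @ U --> wlim t.
  exact: (sconv_ultra_cvg HS UU M0 (c_in t) fc fM).
have wcvgP t e : 0 < e -> \forall n \near U, `|wlim t - cc (f n) (c t)| < e.
  by move=> e0; move: (wcvg t) => /cvgrPdist_lt; apply.
(* The limit inherits the common modulus of the convolutions, with a weak inequality. *)
have equi e : 0 < e -> exists2 d, 0 < d & forall s t, `|s - t| < d ->
    `|wlim s - wlim t| <= e /\ forall n, `|cc (f n) (c s) - cc (f n) (c t)| < e.
  move=> e0; have [d d0 Hd] := sconv_equicontinuous HS a T0 M0 e0.
  exists d => // s t st.
  have H n : `|cc (f n) (c s) - cc (f n) (c t)| < e.
    by apply: (Hd _ (fc n) (fM n)) => //; exact: le_lt_trans st.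
  split => //; apply/ler_addgt0Pr => e' e'0.
  have e'20 : 0 < e' / 2 by rewrite divr_gt0.
  near U => n.
  have h1 : `|wlim s - cc (f n) (c s)| < e' / 2 by near: n; exact: wcvgP.
  have h2 : `|wlim t - cc (f n) (c t)| < e' / 2 by near: n; exact: wcvgP.
  have := ler_distD (cc (f n) (c s)) (wlim s) (wlim t).
  have := ler_distD (cc (f n) (c t)) (cc (f n) (c s)) (wlim t).
  rewrite (distrC (cc (f n) (c t)) (wlim t)); have := H n; lra.
have wlim_c t : wlim (c t) = wlim t by rewrite /wlim c_id.
have unif e : 0 < e -> \forall n \near U, forall t, a <= t <= a + T ->
    `|wlim t - cc (f n) (c t)| < e.
  move=> e0; have e30 : 0 < e / 3 by rewrite divr_gt0.
  apply: segment_near_covering => x xT; have [d d0 Hd] := equi _ e30.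
  exists d => //; near=> n => y yT xy; have [h1 h2] := Hd x y xy.
  have h3 : `|wlim x - cc (f n) (c x)| < e / 3 by near: n; exact: wcvgP.
  have := ler_distD (wlim x) (wlim y) (cc (f n) (c y)).
  have := ler_distD (cc (f n) (c x)) (wlim x) (cc (f n) (c y)).
  rewrite (distrC (wlim y) (wlim x)); have := h2 n; lra.
pose u t := free_path t + wlim t.
have ucont : continuous u.
  move=> t; apply: continuousD; first exact: free_path_continuous.
  move: t; apply: unif_cont_on_continuous => b b' e e0.
  have [d d0 Hd] := equi (e / 2) ltac:(by rewrite divr_gt0).
  by exists d => // s t _ _ /Hd[h _]; lra.
have uunif e : 0 < e -> \forall n \near U, forall t, t <= a + T -> `|un n t - u t| < e.
  move=> e0; apply: filterS (unif e e0) => n Hn t tT.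
  rewrite uE // /u opprD addrACA subrr add0r distrC -wlim_c.
  (* Up to [a + T] the clamp [c] agrees with the one in [duhamel], so the history is covered as
     well. *)
  have -> : duhamel (delayed (un n) (delta n)) t = cc (f n) (c (c t)).
    by rewrite c_id // /c (min_r tT).
  exact: Hn.
pose fu := delayed u 0.
have fuc : continuous fu by exact: delayed_continuous.
(* [B] has no uniform modulus, so uniformity comes from the segment: near each [x], both [f n y] and
   [fu y] are compared with [B x (seg u x)]. The shift of time and the delay each use half of
   [d1]. *)
have funif e : 0 < e -> \forall n \near U, forall s, a <= s <= a + T -> `|f n s - fu s| < e.
  move=> e0; have e20 : 0 < e / 2 by rewrite divr_gt0.
  apply: segment_near_covering => x xT.
  have [d d0 Hd] := BC x (@seg_inC u x ucont) e20.
  have d20 : 0 < d / 2 by rewrite divr_gt0.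
  have [d1 d10 Hd1] := @continuous_unif_cont_on _ _ (a - r - 1) (a + T) u ucont _ d20.
  pose d2 := Num.min d (d1 / 2).
  have d2d : d2 <= d by rewrite ge_min lexx.
  have d2d1 : d2 <= d1 / 2 by rewrite ge_min lexx orbT.
  exists d2; first by rewrite lt_min d0 divr_gt0.
  near=> n => y yT xy.
  have hdel : delta n < d1 / 2.
    near: n; apply: ooU; near=> n.
    apply: (@le_lt_trans _ _ n.+1%:R^-1).
      rewrite /delta -[leRHS]mul1r; apply: ler_pM => //; first exact: ltW.
      by rewrite lef_pV2 ?posrE // ler_nat.
    by near: n; apply: (near_infty_natSinv_lt (PosNum _)); rewrite divr_gt0.
  have hu : forall t, t <= a + T -> `|un n t - u t| < d / 2 by near: n; exact: uunif.
  have hyx : `|y - x| < d by rewrite distrC; lra.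
  move: (xy); rewrite ltr_norml => xy'.
  have dn := delta_gt0 n; have dl := delta_lt n.
  have h1 : `|f n y - B x (seg u x)| < e / 2.
    apply: Hd => //; first exact: seg_inC.
    move=> th thr; rewrite /seg.
    have g1 : `|un n (y - delta n + th) - u (y - delta n + th)| < d / 2 by apply: hu; lra.
    have g2 : `|u (y - delta n + th) - u (x + th)| < d / 2.
      by apply: Hd1; [lra|lra|rewrite ltr_norml; lra].
    have := ler_distD (u (y - delta n + th)) (un n (y - delta n + th)) (u (x + th)); lra.
  have h2 : `|fu y - B x (seg u x)| < e / 2.
    apply: Hd => //; first exact: seg_inC.
    move=> th thr; rewrite /seg subr0.
    have : `|u (y + th) - u (x + th)| < d / 2.
      by apply: Hd1; [lra|lra|rewrite ltr_norml; lra].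
    lra.
  have := ler_distD (B x (seg u x)) (f n y) (fu y); rewrite (distrC (B x (seg u x)) (fu y)); lra.
(* Uniform convergence of [f n] carries over to the convolutions, which identifies the limit along
   [U]. *)
have wlimE t : a <= t <= a + T -> wlim t = cc fu t.
  move=> tT; apply/eqP; rewrite -subr_eq0 -normr_le0; apply/ler_addgt0Pr => e e0.
  rewrite add0r.
  pose E := expR (`|w| * T).
  have E0 : 0 < E by exact: expR_gt0.
  have ET0 : 0 < E * T by rewrite mulr_gt0.
  have e20 : 0 < e / 2 by rewrite divr_gt0.
  near U => n.
  have h1 : `|wlim t - cc (f n) (c t)| < e / 2 by near: n; exact: wcvgP.
  have h2 : forall s, a <= s <= a + T -> `|f n s - fu s| < e / 2 / (E * T).
    by near: n; apply: funif; rewrite divr_gt0.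
  have h3 : `|cc (f n) t - cc fu t| <= E * (e / 2 / (E * T)) * (t - a).
    apply: (sconv_dist HS tT (fc n) fuc); first by rewrite ltW // divr_gt0.
    by move=> s st; apply/ltW/h2; lra.
  have h4 : E * (e / 2 / (E * T)) * (t - a) <= e / 2.
    rewrite (_ : E * _ * _ = e / 2 * ((t - a) / T)); last by field; rewrite !gt_eqF.
    by rewrite ger_pMr // ler_pdivrMr // mul1r; lra.
  rewrite c_id // in h1.
  have := ler_distD (cc (f n) t) (wlim t) (cc fu t); lra.
exists (a + T); split; first by lra.
exists u; split.
- exact: continuous_subspaceT.
- move=> th thr; rewrite /u free_path_history // -wlim_c wlimE //.
  have -> : c (a + th) = a by rewrite /c min_r ?max_l //; lra.
  by rewrite /cc (sconv_xx HS) // addr0.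
- move=> t tT; have at_ : a <= t by lra.
  exists (cc fu t); last by rewrite /u free_path_evolution // wlimE.
  have := sconv_integral HS at_ fuc.
  by apply: eq_is_RS_integral => s _; rewrite /fu /delayed subr0.
Unshelve. all: by end_near. Qed.

End Existence.

Theorem theorem2 (R : realType) (X : completeNormedModType R) (r a w : R)
    (S : R -> X -> X) (G : R -> X -> X -> X) (p : R -> X -> X)
    (g : R -> R -> (R -> X) -> R) (Lp C1 C2 Mvg : R) :
  0 < r ->
  compact_C0_semigroup S w ->
  continuous (fun z : R * (X * X) => G z.1 z.2.1 z.2.2) ->
  0 <= Lp ->
  (forall t u s v, `|p t u - p s v| <= Lp * (`|s - t| + `|u - v|)) ->
  0 <= C1 -> 0 <= C2 ->
  (forall s u, `|p s u| <= C1 * `|u| + C2) ->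
  (* (A1) *)
  0 < Mvg ->
  (forall t phi, inC r phi ->
     bounded_variation (-r) 0 (fun th => g th t phi) /\
     (total_variation (-r) 0 (fun th => g th t phi) <= Mvg%:E)%E) ->
  (* (A2), (A3) *)
  (exists (gc : R -> R -> (R -> X) -> R) (eta h : nat -> R -> (R -> X) -> R),
     jump_decomposition r g gc eta h) ->
  forall phi : R -> X, inC r phi ->
    exists T, a < T /\ exists u : R -> X,
      mild_solution r a T S (Bnl r G p g) phi u.
Proof.
move=> r0 HS Gc Lp0 pL _ _ _ _ bv dec phi iphi.
apply: (mild_solution_exists HS a r0 _ iphi).
apply: (Bnl_continuous (ltW r0) Gc).
exact: (Fnl_continuous r0 Lp0 pL bv dec).
Qed.
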